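(* For each $N$, let $\boldsymbol{y}_N = \boldsymbol{m}_N^0 + \boldsymbol{\varepsilon}_N \in\mathbb{R}^N$, where $\boldsymbol{m}_N^0\in\mathbb{R}^N$ is deterministic and $\boldsymbol{\varepsilon}_N$ is a random vector of independent, zero mean, sub-exponential, continuous components such that $\kappa := \sup_{N\in\mathbb{N}} \max_{1\le i\le N} \|(\boldsymbol{\varepsilon}_N)_i\|_{\psi_1} < \infty$. Let $1=t_0^0<t_1^0<\cdots<t_{M^0-1}^0<t_{M^0}^0=N+1$, where $t_1^0,\dots,t_{M^0-1}^0$ are the change points of $\boldsymbol{m}_N^0$ (these quantities may depend on $N$), write $m_t^0 := (\boldsymbol{m}_N^0)_t$, and let $s_k := \mathrm{sgn}(m^0_{t_k^0}-m^0_{t_{k-1}^0})$, $k=1,\dots,M^0-1$. Suppose that there are positive constants $M_1,\dots,M_5$ and $c_1$, independent of $N$, such that: (a) $M^0\leq M_1$; (b) $\min_{k=1,\dots,M^0} (t_k^0-t_{k-1}^0)\geq M_2 N$; (c) $0<M_3\leq \min_{k=1,\dots,M^0-1} |m^0_{t_k^0}-m^0_{t_k^0-1}|\leq M_4$; (d) $\lambda_N = M_5 N^{c_1}$ with $1/2<c_1<1$; (e) all consecutive signs are different, i.e. $s_k=-s_{k+1}$ for all $k=1,\dots,M^0-2$. Let $\varepsilon>0$ and let $P_N$ be the probability that the optimal solution $\boldsymbol{m}_N$ of the FLSA problem with data $\boldsymbol{y}_N$ and $\lambda=\lambda_N$ fails to recover the true support of $\boldsymbol{m}_N^0$ (in the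 sense of $\varepsilon$-recovery defined in the context). Then $P_N$ is dominated by $\exp(-N^{2c_1-1})$ (where $c_1$ is the exponent of $\lambda_N$), in the sense that there exists a $C>0$ such that $$\lim_{N\to\infty} \frac{-\ln P_N}{N^{2c_1-1}} \leq C.$$
   Context: For data $\boldsymbol{y}=[y_1,\dots,y_N]^T$ and $\lambda>0$, the FLSA (fused lasso signal approximator) problem is $$\min_{m_1,\dots,m_N} \frac12\sum_{t=1}^N (y_t-m_t)^2 + \lambda\sum_{t=2}^N |m_t-m_{t-1}|.$$ A change point of a vector $\boldsymbol{m}\in\mathbb{R}^N$ is an index $t\in\{2,\dots,N\}$ with $m_t\neq m_{t-1}$. $\varepsilon$-recovery of the support: let $\boldsymbol{x}_N,\boldsymbol{x}_N^0\in\mathbb{R}^{N-1}$ be given by $(\boldsymbol{x}_N)_t := (\boldsymbol{m}_N)_{t+1}-(\boldsymbol{m}_N)_t$ and $(\boldsymbol{x}_N^0)_t := (\boldsymbol{m}_N^0)_{t+1}-(\boldsymbol{m}_N^0)_t$; let $K_N^0$ be the set of indices of nonzero entries of $\boldsymbol{x}_N^0$, $I_i^{\varepsilon,N} := \{k\in\{1,\dots,N-1\}: |k-i|<\varepsilon N\}$, and $K_N^\varepsilon := \bigcup_{i\in K_N^0} I_i^{\varepsilon,N}$. Then $\boldsymbol{m}_N$ $\varepsilon$-recovers the support of $\boldsymbol{m}_N^0$ if (i) $(\boldsymbol{x}_N)_k=0$ for all $k\in\{1,\dots,N-1\}\setminus K_N^\varepsilon$, and (ii) for every $i\in K_N^0$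 there is $k\in I_i^{\varepsilon,N}$ with $\mathrm{sgn}((\boldsymbol{x}_N)_k)=\mathrm{sgn}((\boldsymbol{x}_N^0)_i)$. A random variable $x$ is sub-exponential if $(E|x|^p)^{1/p}\leq K p$ for all $p\geq1$ and some constant $K>0$; its sub-exponential norm is $\|x\|_{\psi_1} := \sup_{p\geq1} p^{-1}(E|x|^p)^{1/p}$. ''Continuous'' means having a continuous distribution.
   Formalization: The displayed limit ''≤ C'' fails (noise uniform on [-1/N,1/N], zero signal: P_N = 0 for large N); proved instead is the stated domination: there is C>0 with liminf of -ln P_N / N^{2c_1-1} ≥ C, with liminf since the limit need not exist. *)

(* Defs.v *)
From HB Require Import structures.
From mathcomp Require Import all_boot all_order all_algebra.
From mathcomp Require Import all_classical all_reals all_analysis.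
Set Implicit Arguments.
Unset Strict Implicit.
Unset Printing Implicit Defensive.
Import Order.TTheory GRing.Theory Num.Theory.
Import numFieldNormedType.Exports.
Local Open Scope classical_set_scope.
Local Open Scope ring_scope.

(** Time indices are natural numbers counted from 1, so that formulas read
    [m_1, ..., m_N] although ['I_N] starts at 0.  Only [1 <= t <= N] is
    meaningful: [entry m 0 = entry m 1] and [entry m t = 0] for [N < t]. *)
Definition entry (R : realType) (N : nat) (m : 'rV[R]_N) (t : nat) : R :=
  if insub t.-1 is Some i then m ord0 i else 0.

Definition flsa_objective (R : realType) (N : nat) (lam : R)
    (y m : 'rV[R]_N) : R :=
  2^-1 * (\sum_(1 <= t < N.+1) (entry y t - entry m t) ^+ 2)
  + lam * \sum_(2 <= t < N.+1) `|entry m t - entry m t.-1|.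

(** For [0 < lam] the objective is strictly convex and coercive: there is
    exactly one such [m]. *)
Definition flsa_solution (R : realType) (N : nat) (lam : R)
    (y m : 'rV[R]_N) : Prop :=
  forall m' : 'rV[R]_N, flsa_objective lam y m <= flsa_objective lam y m'.

Definition change_points (R : realType) (N : nat) (m : 'rV[R]_N) : seq nat :=
  [seq t <- index_iota 2 N.+1 | entry m t != entry m t.-1].

(** The number of segments of [m], i.e. [M^0]. *)
Definition nsegments (R : realType) (N : nat) (m : 'rV[R]_N) : nat :=
  (size (change_points m)).+1.

(** [t_k] for [0 <= k <= M^0]: the increasing list of the change points,
    preceded by [t_0 = 1] and followed by [t_(M^0) = N + 1]. *)
Definition cpt (R : realType) (N : nat) (m : 'rV[R]_N) (k : nat) : nat :=
  nth 0%N (1%N :: rcons (change_points m) N.+1) k.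

Definition jump_sign (R : realType) (N : nat) (m : 'rV[R]_N) (k : nat) : R :=
  Num.sg (entry m (cpt m k) - entry m (cpt m k.-1)).

(** The vector [x] of increments, [1 <= t <= N - 1]. *)
Definition increment (R : realType) (N : nat) (m : 'rV[R]_N) (t : nat) : R :=
  entry m t.+1 - entry m t.

Definition increment_support (R : realType) (N : nat) (m : 'rV[R]_N) :
    set nat :=
  [set k | (1 <= k < N)%N /\ increment m k <> 0].

(** The neighbourhood [I_i^(e,N)]. *)
Definition index_window (R : realType) (N : nat) (e : R) (i : nat) : set nat :=
  [set k | (1 <= k < N)%N /\ `|k%:R - i%:R| < e * N%:R].

Definition recovers_support (R : realType) (N : nat) (e : R)
    (m m0 : 'rV[R]_N) : Prop :=
  (forall k, (1 <= k < N)%N ->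
     ~ (\bigcup_(i in increment_support m0) index_window N e i) k ->
     increment m k = 0)
  /\ (forall i, increment_support m0 i ->
      exists2 k, index_window N e i k &
        Num.sg (increment m k) = Num.sg (increment m0 i)).

(** Taking [B i = setT] outside a subset of the indices gives the product
    rule for every subfamily. *)
Definition mutually_independent (R : realType) (d : measure_display)
    (T : measurableType d) (P : probability T R) (N : nat)
    (X : 'I_N -> {RV P >-> R}) : Prop :=
  forall B : 'I_N -> set R, (forall i, measurable (B i)) ->
    P (\bigcap_i (X i @^-1` B i)) = (\prod_i P (X i @^-1` B i))%E.

Definition sub_exponential (R : realType) (d : measure_display)
    (T : measurableType d) (P : probability T R) (X : {RV P >-> R}) : Prop :=
  exists2 K : R, 0 < K &
    forall p : R, 1 <= p -> ('N[P]_p%:E[EFin \o X] <= (K * p)%:E)%E.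

Definition psi1_norm (R : realType) (d : measure_display)
    (T : measurableType d) (P : probability T R) (X : {RV P >-> R}) : \bar R :=
  ereal_sup [set ((p^-1)%:E * 'N[P]_p%:E[EFin \o X])%E | p in [set p : R | 1 <= p]].

Definition continuous_distribution (R : realType) (d : measure_display)
    (T : measurableType d) (P : probability T R) (X : {RV P >-> R}) : Prop :=
  continuous (cdf X).

(** Domination of the probabilities [p n] by [exp (- u n)] on the logarithmic
    scale: for some [C > 0] and every [C' < C], eventually
    [p n <= exp (- C' * u n)].  The source writes the exponent bound as
    [lim (- ln (p n) / u n) <= C], which would bound [p n] from below; being
    dominated is the upper bound, i.e. [ln (p n) / u n] is asymptotically at
    most [- C].  The limit inferior is used because the limit need not exist;
    [lne 0 = -oo], so [p n = 0] is allowed. *)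
Definition exp_dominated (R : realType) (p : nat -> \bar R) (u : nat -> R) :
    Prop :=
  exists2 C : R, 0 < C &
    (C%:E <= limn_einf (fun n => - lne (p n) * ((u n)^-1)%:E))%E.

(* Main.v *)
Require Import Defs.
From HB Require Import structures.
From mathcomp Require Import all_boot all_order all_algebra.
From mathcomp Require Import all_classical all_reals all_analysis.
From mathcomp Require Import measurable_realfun ring lra zify.
Set Implicit Arguments.
Unset Strict Implicit.
Unset Printing Implicit Defensive.
Import Order.TTheory GRing.Theory Num.Theory.
Import numFieldNormedType.Exports.
Local Open Scope classical_set_scope.
Local Open Scope ring_scope.

(** The KKT conditions say that the partial sums of the solution form a taut
    string: they stay within [lam] of the partial sums of the data, touching the
    upper (lower) obstacle where the solution jumps up (down).

    Suppose that all partial sums of the noise are at most [delta lam / 2].  Over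
    a window of length proportional to [N] the string cannot miss a jump of the
    true signal, because [lam / N] tends to 0; so there is a kink of the right
    sign near each change point.  As consecutive signs differ, on each segment
    the string runs from one obstacle to the other, so its mean slope differs
    from the true level by order [lam / N].  A further kink far from the ends of
    the segment would force slopes on the wrong side of the true level, up to
    [delta lam / (e N)], which is impossible for small [delta].

    The noise condition fails with probability at most
    [2 (N + 1) exp (- c lam ^ 2 / N)]: sub-exponential moments bound the moment
    generating function near 0 by that of a Gaussian, Chernoff's bound applies
    since [lam / N] is small, and [lam ^ 2 / N] is of order [N ^ (2 c1 - 1)].

    The failure event is measurable because the solution is a nonexpansive
    function of the data. *)

(** * Moment generating functions of independent variables *)

Section independence.
Context (R : realType) (d : measure_display) (T : measurableType d).

Import HBNNSimple.

Let simple_funE (h : {nnsfun R >-> R}) (y : R) :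
  (h y)%:E = (\sum_(r \in range h) (r * \1_(h @^-1` [set r]) y)%:E)%E.
Proof. by rewrite fimfunE -fsumEFin. Qed.

(** Both sides respect linear combinations and increasing limits in [g], so simple functions
    approximating [g] from below reduce the claim to indicators. With a constant [Z2] this turns
    independence of events into independence under the integral. *)
Lemma eq_integral_weighted (mu : {measure set T -> \bar R}) (X Z1 Z2 : T -> R)
    (g : R -> R) :
  measurable_fun setT X -> measurable_fun setT Z1 -> measurable_fun setT Z2 ->
  measurable_fun setT g ->
  (forall x, 0 <= Z1 x) -> (forall x, 0 <= Z2 x) -> (forall y, 0 <= g y) ->
  (forall B : set R, measurable B ->
    (\int[mu]_x (Z1 x * \1_B (X x))%:E = \int[mu]_x (Z2 x * \1_B (X x))%:E)%E) ->
  (\int[mu]_x (Z1 x * g (X x))%:E = \int[mu]_x (Z2 x * g (X x))%:E)%E.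
Proof.
move=> mX mZ1 mZ2 mg Z10 Z20 g0 H.
have mg' : measurable_fun setT (fun y : R => (g y)%:E).
    by exact/measurable_EFinP.
pose h := nnsfun_approx measurableT mg'.
have hcvg y : (h n y)%:E @[n --> \oo] --> (g y)%:E.
  by apply: (cvg_nnsfun_approx measurableT mg') => // z _ /=; rewrite lee_fin.
have step (Z : T -> R) : measurable_fun setT Z -> (forall x, 0 <= Z x) ->
  (\int[mu]_x (Z x * g (X x))%:E =
   limn (fun n => \int[mu]_x (Z x * h n (X x))%:E))%E.
  move=> mZ Z0.
  rewrite -monotone_convergence //.
  - apply: eq_integral => x _; apply/esym/cvg_lim => //.
    under eq_fun do rewrite EFinM.
    by rewrite EFinM; apply: cvgeZl => //; exact: hcvg.
  - move=> n; apply/measurable_EFinP/measurable_funM => //.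
    by apply: measurableT_comp.
  - by move=> n x _; rewrite lee_fin mulr_ge0.
  - move=> x _ m n mn; rewrite lee_fin ler_wpM2l//.
    exact/lefP/nd_nnsfun_approx.
have simple (Z : T -> R) n : measurable_fun setT Z -> (forall x, 0 <= Z x) ->
  (\int[mu]_x (Z x * h n (X x))%:E = \sum_(r \in range (h n))
    (r%:E * \int[mu]_x (Z x * \1_(h n @^-1` [set r]) (X x))%:E))%E.
  move=> mZ Z0.
  have m1 r : measurable_fun setT
      (fun x => (Z x * \1_(h n @^-1` [set r]) (X x))%:E).
    apply/measurable_EFinP/measurable_funM => //.
    by apply: measurableT_comp.
  transitivity (\int[mu]_x \sum_(r \in range (h n))
      (r%:E * (Z x * \1_(h n @^-1` [set r]) (X x))%:E))%E.
    apply: eq_integral => x _.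
    rewrite EFinM simple_funE ge0_mule_fsumr; last first.
      by move=> r; rewrite EFinM nnfun_muleindic_ge0.
    by apply: eq_fsbigr => r _; rewrite !EFinM muleCA.
  rewrite ge0_integral_fsum//; last 2 first.
  - by move=> r; apply: emeasurable_funM.
  - move=> r x _; rewrite [X in (_ * X)%E]EFinM muleCA mule_ge0 ?lee_fin//.
    exact: nnfun_muleindic_ge0.
  apply: eq_fsbigr => r /[!inE] -[y _ yr].
  by rewrite ge0_integralZl// ?lee_fin -?yr// => x _; rewrite lee_fin mulr_ge0.
rewrite !step//; congr (limn _); apply/funext => n.
by rewrite !simple//; apply: eq_fsbigr => r _; rewrite H.
Qed.

(** Induction on the number [k] of factors that may be arbitrary, the others being indicators. For
    [k = 0] this is the product rule for events; each step frees one more factor, the product of the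
    others being a weight that may be replaced by its mean. *)
Lemma integral_prod_independent (P : probability T R) (N : nat)
    (X : 'I_N -> {RV P >-> R}) (g : 'I_N -> R -> R) (c : 'I_N -> R) :
  mutually_independent X ->
  (forall i, measurable_fun setT (g i)) -> (forall i y, 0 <= g i y) ->
  (forall i, (\int[P]_x (g i (X i x))%:E = (c i)%:E)%E) ->
  (\int[P]_x (\prod_i g i (X i x))%:E = (\prod_i c i)%:E)%E.
Proof.
move=> indep mg g0 gc.
suff H (k : nat) : forall g : 'I_N -> R -> R, forall c : 'I_N -> R,
    (forall i, measurable_fun setT (g i)) -> (forall i y, 0 <= g i y) ->
    (forall i, (\int[P]_x (g i (X i x))%:E = (c i)%:E)%E) ->
    (forall i : 'I_N, (k <= i)%N -> exists2 B : set R, measurable B & g i = \1_B) ->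
    (\int[P]_x (\prod_i g i (X i x))%:E = (\prod_i c i)%:E)%E.
  by apply: (H N) => // i; rewrite leqNgt ltn_ord.
elim: k {g c mg g0 gc} => [|k IH] g c mg g0 gc gB.
  have /choice[B BP] : forall i, exists B : set R, measurable B /\ g i = \1_B.
    by move=> i; have [B] := gB i isT; exists B.
  transitivity (\int[P]_x (\1_(\bigcap_i (X i @^-1` B i)) x)%:E)%E.
    apply: eq_integral => x _; congr EFin.
    under eq_bigr do rewrite (BP _).2 indicE.
    rewrite indicE; case: (boolP (x \in _)) => [|] xB.
      apply: big1 => i _; rewrite inE in xB.
      by rewrite mem_set//; exact: xB.
    have [i] : exists i, X i x \notin B i.
      apply/existsP; rewrite -negb_forall; apply: contra xB => /forallP xB.
      by rewrite inE => i _ /=; have := xB i; rewrite inE.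
    by move=> /negbTE Xi; rewrite (bigD1 i)//= Xi mul0r.
  rewrite integral_indic//; last first.
    apply: fin_bigcap_measurable => [|i _]; first exact: finite_finset.
    rewrite -[X in measurable X]setTI.
    by apply: measurable_funP => //; have [] := BP i.
  rewrite setIT; transitivity (\prod_i P (X i @^-1` B i))%E.
    by apply: indep => i; have [] := BP i.
  rewrite -prodEFin; apply: eq_bigr => i _; rewrite -gc.
  have [mB ->] := BP i.
  transitivity (\int[P]_x (\1_(X i @^-1` B i) x)%:E)%E; last first.
    by apply: eq_integral => x _; rewrite !indicE.
  rewrite integral_indic ?setIT//.
  by rewrite -[X in measurable X]setTI; exact: measurable_funP.
have [Nk|kN] := leqP N k.
  apply: IH => // i ki; exfalso; move: (ltn_ord i).
  by rewrite ltnNge (leq_trans Nk).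
pose j := Ordinal kN.
(* With an indicator at place [j] the induction hypothesis applies, and it supplies the comparison
   on indicators of the weights [Z] and [C]. *)
pose g' B i := if i == j then \1_B else g i : R -> R.
pose Z x := \prod_(i | i != j) g i (X i x).
have mX i : measurable_fun setT (X i) by [].
have mZ : measurable_fun setT Z.
  rewrite /Z; under eq_fun do rewrite -big_filter.
  by apply: measurable_prod => i _; exact: measurableT_comp.
have Z0 x : 0 <= Z x by exact: prodr_ge0.
have c0 i : 0 <= c i.
  by rewrite -lee_fin -gc; apply: integral_ge0 => x _; rewrite lee_fin.
pose C := \prod_(i | i != j) c i.
have C0 : 0 <= C by exact: prodr_ge0.
transitivity (\int[P]_x (Z x * g j (X j x))%:E)%E.
  by apply: eq_integral => x _; rewrite (bigD1 j)//= mulrC.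
rewrite (@eq_integral_weighted _ (X j) Z (cst C) (g j))//; last first.
  move=> B mB.
  have m1 : measurable (X j @^-1` B).
    by rewrite -[X in measurable X]setTI; exact: measurable_funP.
  have EB : (\int[P]_x (\1_B (X j x))%:E = P (X j @^-1` B))%E.
    transitivity (\int[P]_x (\1_(X j @^-1` B) x)%:E)%E.
      by apply: eq_integral => x _; rewrite !indicE.
    by rewrite integral_indic ?setIT.
  transitivity (\int[P]_x (\prod_i g' B i (X i x))%:E)%E.
    apply: eq_integral => x _; rewrite (bigD1 j)//= /g' eqxx mulrC.
    by congr (_ * _)%:E; apply: eq_bigr => i /negbTE ->.
  rewrite (IH _ (fun i => if i == j then fine (P (X j @^-1` B)) else c i)).
  - rewrite (bigD1 j)//= eqxx.
    under eq_bigr => i /negbTE -> do [].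
    under eq_integral do rewrite EFinM.
    rewrite ge0_integralZl ?lee_fin//; last first.
      by apply/measurable_EFinP; apply: measurableT_comp.
    by rewrite EB mulrC EFinM fineK// fin_num_measure.
  - by move=> i; rewrite /g'; case: ifP => _ //; exact: measurable_indic.
  - by move=> i y; rewrite /g'; case: ifP.
  - move=> i; rewrite /g'; case: eqP => [->|_]; last exact: gc.
    by rewrite EB fineK// fin_num_measure.
  - move=> i; rewrite leq_eqVlt => /orP[/eqP ki|ki]; rewrite /g'.
      have -> : i == j by apply/eqP/val_inj.
      by exists B.
    have /negbTE -> : i != j by rewrite -val_eqE/= gtn_eqF.
    exact: gB.
under eq_integral do rewrite EFinM /=.
rewrite ge0_integralZl ?lee_fin//; last 2 first.
- by apply/measurable_EFinP; exact: measurableT_comp.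
- by move=> x _; rewrite lee_fin.
by rewrite gc -EFinM (bigD1 j)//= mulrC.
Qed.

End independence.

(** * Moment generating function of a sub-exponential variable *)

Section sub_exponential_mgf.
Context (R : realType).

(** The Taylor remainder is compared term by term with absolute values. A nonnegative extended real
    series needs no convergence argument and can be exchanged with the integral. *)
Lemma expR_Taylor2_le (u : R) :
  ((expR u - 1 - u)%:E <= \sum_(n <oo) (`|u| ^+ n.+2 / n.+2`!%:R)%:E)%E.
Proof.
have cvg0 : series (exp_coeff u) (n + 2)%N @[n --> \oo] --> expR u.
  by rewrite cvg_shiftn; exact: is_cvg_series_exp_coeff.
have cvg1 : (series (exp_coeff u) (n + 2)%N - 1 - u)%:E @[n --> \oo]
    --> (expR u - 1 - u)%:E.
  apply: cvg_EFin; first by near=> n.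
  by apply: cvgB; [apply: cvgB => //|]; exact: cvg_cst.
apply: (cvge_to_le cvg1); apply: nearW => n.
have a0 k : (0 <= (`|u| ^+ k.+2 / k.+2`!%:R)%:E)%E.
  by rewrite lee_fin divr_ge0 ?exprn_ge0.
apply: le_trans (@nneseries_lim_ge _ _ xpredT 0%N n _); last by move=> *.
rewrite sumEFin lee_fin /series/= addn2 big_nat_recl// big_nat_recl//.
rewrite /exp_coeff/= expr0 fact0 divr1 expr1 divr1.
rewrite [leLHS](_ : _ = \sum_(0 <= i < n) (u ^+ i.+2 / i.+2`!%:R)); last by ring.
apply: ler_sum => i _; rewrite ler_wpM2r// -normrX.
exact: ler_norm.
Unshelve. all: by end_near. Qed.

(** [n ^ n / n!] is a single term of the exponential series of [e ^ n]. *)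
Lemma exprnn_le_fact (n : nat) : (n%:R : R) ^+ n <= n`!%:R * expR 1 ^+ n.
Proof.
case: n => [|n]; first by rewrite !expr0 mulr1.
rewrite -expRM_natr mul1r mulrC -ler_pdivrMr ?ltr0n ?fact_gt0//.
by apply: le_trans (expR_ge1Dxn n (ler0n R n.+1)); rewrite lerDr.
Qed.

Lemma sum_exprn_half_le (q : R) (n : nat) : 0 <= q <= 2^-1 ->
  \sum_(0 <= i < n) q ^+ i.+2 <= 2 * q ^+ 2.
Proof.
move=> /andP[q0 q1].
(* Strengthened for the induction: since [q <= 1/2], the subtracted term pays for the next power. *)
suff : \sum_(0 <= i < n) q ^+ i.+2 <= 2 * q ^+ 2 - 2 * q ^+ n.+2.
  by move/le_trans; apply; rewrite gerBl mulr_ge0// exprn_ge0.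
elim: n => [|n IH]; first by rewrite big_nil subrr.
rewrite big_nat_recr//= (le_trans (lerD IH (lexx _)))//.
rewrite -[leLHS]addrA lerD2l [q ^+ n.+3]exprS.
have := exprn_ge0 n.+2 q0; nra.
Qed.

(** The zero mean removes the linear term of the exponential. Since [n ^ n <= n! e ^ n], the moment
    bounds make the [n]-th Taylor term at most [q ^ n] with [q = e K |t| <= 1/2]; the remainder is
    then at most [2 q ^ 2], and [1 + x <= exp x] concludes. *)
Lemma mgf_le d (T : measurableType d) (P : probability T R) (X : {RV P >-> R})
    (K t : R) : 0 < K -> 'E_P[X]%E = 0%E ->
  (forall n, (0 < n)%N ->
    (\int[P]_x (`|X x| ^+ n)%:E <= ((K * n%:R) ^+ n)%:E)%E) ->
  expR 1 * K * `|t| <= 2^-1 ->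
  (\int[P]_x (expR (t * X x))%:E <= (expR (2 * (expR 1 * K * t) ^+ 2))%:E)%E.
Proof.
move=> K0 EX0 mom tK.
have mX : measurable_fun setT X by [].
have iX : P.-integrable setT (EFin \o X).
  apply/integrableP; split; first exact/measurable_EFinP.
  apply: le_lt_trans (ltry ((K * 1) ^+ 1)).
  have := mom 1%N isT; apply: le_trans.
  by rewrite le_eqVlt; apply/orP; left; apply/eqP/eq_integral => x _ /=.
pose r u : R := expR u - 1 - u.
have r0 u : 0 <= r u by rewrite /r; have := expR_ge1Dx u; lra.
have mtX : measurable_fun setT (fun x => t * X x) by exact: measurable_funM.
have mr : measurable_fun setT (fun x => (r (t * X x))%:E).
  apply/measurable_EFinP/measurable_funB => //; apply: measurable_funB => //.
  by apply: measurableT_comp.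
set q := expR 1 * K * `|t| in tK.
have q0 : 0 <= q by rewrite /q !mulr_ge0 ?expR_ge0// ltW.
have Ir : (\int[P]_x (r (t * X x))%:E <= (2 * q ^+ 2)%:E)%E.
  have tm n : measurable_fun setT
      (fun x => (`|t * X x| ^+ n.+2 / n.+2`!%:R)%:E).
    apply/measurable_EFinP/measurable_funM => //.
    by apply: measurable_funX; exact: measurableT_comp.
  have t0 n x : (0 <= (`|t * X x| ^+ n.+2 / n.+2`!%:R)%:E)%E.
    by rewrite lee_fin divr_ge0 ?exprn_ge0.
  apply: (@le_trans _ _ (\int[P]_x (\sum_(n <oo)
      (`|t * X x| ^+ n.+2 / n.+2`!%:R)%:E))%E).
    apply: ge0_le_integral => //.
    - by move=> x _; rewrite lee_fin.
    - by apply: ge0_emeasurable_sum => //.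
    - by move=> x _; exact: expR_Taylor2_le.
  rewrite integral_nneseries//.
  apply: lime_le; first by apply: is_cvg_nneseries => n _ _; exact: integral_ge0.
  apply: nearW => n.
  apply: (@le_trans _ _ (\sum_(0 <= i < n) (q ^+ i.+2)%:E)%E); last first.
    by rewrite sumEFin lee_fin sum_exprn_half_le// q0.
  apply: lee_sum => i _.
  rewrite (eq_integral (fun x => (`|t| ^+ i.+2 / i.+2`!%:R)%:E *
      (`|X x| ^+ i.+2)%:E)%E); last first.
    by move=> x _; rewrite -EFinM normrM exprMn; congr EFin; ring.
  have k0 : 0 <= `|t| ^+ i.+2 / i.+2`!%:R by rewrite divr_ge0 ?exprn_ge0.
  rewrite ge0_integralZl//; last first.
    by apply/measurable_EFinP/measurable_funX; exact: measurableT_comp.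
  apply: (@le_trans _ _ ((`|t| ^+ i.+2 / i.+2`!%:R)%:E * ((K * i.+2%:R) ^+ i.+2)%:E)%E).
    by apply: lee_wpmul2l; rewrite ?lee_fin//; exact: mom.
  rewrite -EFinM lee_fin mulrAC ler_pdivrMr ?ltr0n ?fact_gt0// /q !exprMn.
  rewrite [leLHS](_ : _ = `|t| ^+ i.+2 * K ^+ i.+2 * i.+2%:R ^+ i.+2); last by ring.
  rewrite [leRHS](_ : _ = `|t| ^+ i.+2 * K ^+ i.+2 *
    (i.+2`!%:R * expR 1 ^+ i.+2)); last by ring.
  by rewrite ler_wpM2l ?exprnn_le_fact// mulr_ge0// exprn_ge0// ltW.
have ir : P.-integrable setT (fun x => (r (t * X x))%:E).
  apply/integrableP; split => //.
  apply: le_lt_trans (ltry (2 * q ^+ 2)); apply: le_trans Ir.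
  rewrite le_eqVlt; apply/orP; left; apply/eqP/eq_integral => x _.
  by rewrite gee0_abs ?lee_fin.
have i1 : P.-integrable setT (fun x => (1 + t * X x)%:E).
  rewrite (_ : (fun _ => _) = (cst 1 \+ (fun x => t%:E * (X x)%:E))%E).
    apply: integrableD => //; first exact: finite_measure_integrable_cst.
    exact: integrableZl.
  by apply/funext => x /=; rewrite EFinD EFinM.
rewrite (eq_integral (fun x => (1 + t * X x)%:E + (r (t * X x))%:E)%E); last first.
  by move=> x _; rewrite -EFinD; congr EFin; rewrite /r; ring.
rewrite integralD//.
have -> : (\int[P]_x (1 + t * X x)%:E = 1)%E.
  under eq_integral do rewrite EFinD EFinM.
  rewrite integralD//; last 2 first.
  - exact: finite_measure_integrable_cst.
  - exact: integrableZl.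
  rewrite integralZl// integral_cst//=.
  move: EX0; rewrite unlock => ->.
  by rewrite mule0 adde0 probability_setT mul1e.
apply: (@le_trans _ _ (1 + (2 * q ^+ 2)%:E)%E); first by rewrite leeD2l.
rewrite -EFinD lee_fin (le_trans (expR_ge1Dx _))//.
by rewrite ler_expR /q !exprMn real_normK// num_real.
Qed.

Lemma psi1_moment d (T : measurableType d) (P : probability T R)
    (X : {RV P >-> R}) (K : R) (n : nat) :
  (psi1_norm X <= K%:E)%E -> (0 < n)%N ->
  (\int[P]_x (`|X x| ^+ n)%:E <= ((K * n%:R) ^+ n)%:E)%E.
Proof.
move=> XK n0.
have nR0 : n%:R != 0 :> R by rewrite pnatr_eq0 -lt0n.
have N : ('N[P]_(n%:R)%:E[EFin \o X] <= (K * n%:R)%:E)%E.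
  have : ((n%:R^-1)%:E * 'N[P]_(n%:R)%:E[EFin \o X] <= K%:E)%E.
    apply: le_trans XK; apply: ereal_sup_ubound.
    by exists n%:R => //=; rewrite ler1n.
  by rewrite lee_pdivrMl ?ltr0n// EFinM muleC.
have K0 : 0 <= K * n%:R by rewrite -lee_fin (le_trans _ N)// Lnorm_ge0.
rewrite -[leRHS]/(((K * n%:R) ^+ n)%:E) -powR_mulrn// -poweR_EFin.
apply: le_trans (gt0_ler_poweR _ _ _ N); rewrite ?in_itv/= ?andbT ?leey ?Lnorm_ge0//;
  last by rewrite lee_fin K0.
rewrite poweR_Lnorm//.
rewrite le_eqVlt; apply/orP; left; apply/eqP/eq_integral => x _ /=.
by rewrite powR_mulrn.
Qed.

End sub_exponential_mgf.

(** * Tail bounds for sums of the noise *)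

(** Chernoff's method: Markov's inequality for [exp (t Y)], whose mean factors by independence. The
    upper bound on [s] keeps [t] in the range where the Gaussian bound on each factor holds. *)
Lemma weighted_sum_tail (R : realType) d (T : measurableType d)
    (P : probability T R) (N : nat) (X : 'I_N -> {RV P >-> R})
    (sigma : 'I_N -> R) (K s : R) :
  mutually_independent X -> (forall i, 'E_P[X i]%E = 0%E) -> 0 < K ->
  (forall i, (psi1_norm (X i) <= K%:E)%E) ->
  (forall i, `|sigma i| <= 1) -> (0 < N)%N ->
  0 <= s <= 2 * (expR 1 * K) * N%:R ->
  (P [set x | s <= \sum_i sigma i * X i x]%R <=
    (expR (- (s ^+ 2 / (8 * (expR 1 * K) ^+ 2 * N%:R))))%:E)%E.
Proof.
move=> indep mean0 K0 psi1K sigma1 N0 /andP[s0 sN].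
set A := expR 1 * K in sN *.
have A0 : 0 < A by rewrite mulr_gt0// expR_gt0.
have NR0 : 0 < N%:R :> R by rewrite ltr0n.
(* Minimises the exponent [- t s + 2 N (A t) ^ 2]; the minimum is [- s ^ 2 / (8 A ^ 2 N)]. *)
pose t := s / (4 * A ^+ 2 * N%:R).
have t0 : 0 <= t by rewrite divr_ge0 ?mulr_ge0 ?exprn_ge0 // ltW.
have At : A * t <= 2^-1.
  rewrite /t mulrA ler_pdivrMr ?mulr_gt0 ?exprn_gt0//.
  rewrite [leRHS](_ : _ = A * (2 * A * N%:R)); last by field.
  by rewrite ler_wpM2l// ltW.
pose Y x := \sum_i sigma i * X i x.
have mX i : measurable_fun setT (X i) by [].
have mY : measurable_fun setT Y.
  by apply: measurable_sum => i; exact: measurable_funM.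
pose g i (y : R) : R := expR (t * sigma i * y).
have mg i : measurable_fun setT (g i).
  by apply: measurableT_comp => //; exact: measurable_funM.
have g0 i y : 0 <= g i y by exact: expR_ge0.
have Ig i : (\int[P]_x (g i (X i x))%:E <= (expR (2 * (A * t) ^+ 2))%:E)%E.
  have ts : `|t * sigma i| <= t.
    by rewrite normrM (ger0_norm t0) -[leRHS]mulr1 ler_wpM2l.
  apply: (@le_trans _ _ (expR (2 * (A * (t * sigma i)) ^+ 2))%:E).
    apply: (@mgf_le _ _ _ P (X i)) => //.
      by move=> n; apply: psi1_moment.
    by apply: le_trans At; rewrite ler_wpM2l// ltW.
  rewrite lee_fin ler_expR ler_wpM2l// -[leLHS]real_normK ?num_real//.
  have At0 : 0 <= A * t by rewrite mulr_ge0// ltW.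
  rewrite lerXn2r ?nnegrE//.
  by rewrite normrM (gtr0_norm A0) ler_wpM2l// ltW.
pose c i := fine (\int[P]_x (g i (X i x))%:E)%E.
have Ige0 i : (0 <= \int[P]_x (g i (X i x))%:E)%E.
  by apply: integral_ge0 => x _; rewrite lee_fin.
have Ic i : (\int[P]_x (g i (X i x))%:E = (c i)%:E)%E.
  by rewrite fineK// ge0_fin_numE// (le_lt_trans (Ig i))// ltry.
have prodE := integral_prod_independent indep mg g0 Ic.
have c0 i : 0 <= c i by rewrite -lee_fin -Ic.
have cle : \prod_i c i <= expR (2 * (A * t) ^+ 2) ^+ N.
  rewrite -[in leRHS](card_ord N) -prodr_const.
  by apply: ler_prod => i _; rewrite c0/= -lee_fin -Ic.
have mE : measurable [set x | s <= Y x].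
  rewrite (_ : [set x | s <= Y x] = setT `&` Y @^-1` `[s, +oo[).
    by apply: mY => //; exact: measurable_itv.
  by rewrite setTI; apply/seteqP; split => x /=; rewrite in_itv/= andbT.
apply: (@le_trans _ _ (\int[P]_x (\1_[set x | s <= Y x] x)%:E)%E).
  by rewrite integral_indic// setIT.
apply: (@le_trans _ _ (\int[P]_x ((expR (- (t * s)))%:E *
    (\prod_i g i (X i x))%:E))%E).
  apply: ge0_le_integral => //.
  - by apply/measurable_EFinP; exact: measurable_indic.
  - apply/measurable_EFinP/measurable_funM => //.
    by apply: measurable_prod => i _; exact: measurableT_comp.
  move=> x _; rewrite -EFinM lee_fin -expR_sum -expRD indicE.
  have [/set_mem/= sY|_] := boolP (x \in _); last by rewrite expR_ge0.
  rewrite -[leLHS]expR0 ler_expR.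
  under eq_bigr do rewrite -mulrA.
  by rewrite -mulr_sumr addrC -mulrBr mulr_ge0// subr_ge0.
rewrite ge0_integralZl ?lee_fin ?expR_ge0//; last 2 first.
- apply/measurable_EFinP/measurable_prod => i _; exact: measurableT_comp.
- by move=> x _; rewrite lee_fin prodr_ge0.
rewrite prodE -EFinM lee_fin.
apply: (@le_trans _ _ (expR (- (t * s)) * expR (2 * (A * t) ^+ 2) ^+ N)).
  by rewrite ler_wpM2l ?expR_ge0.
rewrite -expRM_natr -expRD ler_expR le_eqVlt; apply/orP; left; apply/eqP.
by rewrite /t; field; rewrite !gt_eqF.
Qed.

(** Union bound over the [N + 1] partial sums and both signs, each case being a sum with weights of
    modulus at most 1. *)
Lemma partial_sums_tail (R : realType) d (T : measurableType d)
    (P : probability T R) (N : nat) (X : 'I_N -> {RV P >-> R}) (K s : R)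
    (F : set T) :
  mutually_independent X -> (forall i, 'E_P[X i]%E = 0%E) -> 0 < K ->
  (forall i, (psi1_norm (X i) <= K%:E)%E) -> (0 < N)%N ->
  0 <= s <= 2 * (expR 1 * K) * N%:R -> measurable F ->
  (forall x, F x -> exists2 t : nat, (t <= N)%N &
    s <= `|\sum_(i < N | (i < t)%N) X i x|) ->
  (P F <= (2 * N.+1%:R *
    expR (- (s ^+ 2 / (8 * (expR 1 * K) ^+ 2 * N%:R))))%:E)%E.
Proof.
move=> indep mean0 K0 psi1K N0 sN mF FE.
set B := expR _.
pose half (t : nat) (b : bool) : set T :=
  [set x | s <= \sum_(i < N) ((-1) ^+ b * (i < t)%:R) * X i x].
have mX i : measurable_fun setT (X i) by [].
have mhalf t b : measurable (half t b).
  pose Y x := \sum_(i < N) ((-1) ^+ b * (i < t)%:R) * X i x.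
  rewrite (_ : half t b = setT `&` Y @^-1` `[s, +oo[).
    suff mY : measurable_fun setT Y by apply: mY => //; exact: measurable_itv.
    by apply: measurable_sum => i; exact: measurable_funM.
  by rewrite setTI; apply/seteqP; split => x /=; rewrite in_itv/= andbT.
have Phalf t b : (P (half t b) <= B%:E)%E.
  apply: weighted_sum_tail => // i.
  by rewrite normrM normrX normrN1 expr1n mul1r normr_nat lern1 leq_b1.
pose A t := half t false `|` half t true.
have mA t : measurable (A t) by exact: measurableU.
have PA t : (P (A t) <= (2 * B)%:E)%E.
  apply: (@le_trans _ _ (P (half t false) + P (half t true))%E).
    exact: measureU2.
  by rewrite mulr2n mulrDl mul1r EFinD leeD.
apply: (@le_trans _ _ (P (\big[setU/set0]_(t < N.+1) A t))).
  apply: le_measure; rewrite ?inE//; first exact: bigsetU_measurable.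
  move=> x /FE[t tN sx]; rewrite -bigcup_mkord; exists t => //=.
  case: (ger0P (\sum_(i < N | (i < t)%N) X i x)) sx => [s0|s0] sx.
    left; rewrite /half/= (le_trans sx)// [leLHS]big_mkcond/=.
    by apply: ler_sum => i _; rewrite expr0 mul1r; case: ifP => _; rewrite ?mul1r ?mul0r.
  right; rewrite /half/= (le_trans sx)// -sumrN [leLHS]big_mkcond/=.
  apply: ler_sum => i _; rewrite expr1 mulN1r.
  by case: ifP => _; rewrite ?mulN1r ?oppr0 ?mul0r.
apply: (@le_trans _ _ (\sum_(t < N.+1) P (A t))%E); first exact: Boole_inequality.
apply: (@le_trans _ _ (\sum_(t < N.+1) (2 * B)%:E)%E); first exact: lee_sum.
by rewrite sumEFin sumr_const card_ord -[X in (X%:E <= _)%E]mulr_natr lee_fin mulrAC.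
Qed.

(** * Optimality conditions and the taut string *)

Section optimality.
Context (R : realType).

Lemma entry_succ (N : nat) (m : 'rV[R]_N) (i : 'I_N) : entry m i.+1 = m ord0 i.
Proof. by rewrite /entry /= valK. Qed.

Lemma entryD (N : nat) (m m' : 'rV[R]_N) t :
  entry (m + m') t = entry m t + entry m' t.
Proof. by rewrite /entry; case: insub => [i|]; rewrite ?mxE// addr0. Qed.

Lemma entryN (N : nat) (m : 'rV[R]_N) t : entry (- m) t = - entry m t.
Proof. by rewrite /entry; case: insub => [i|]; rewrite ?mxE// oppr0. Qed.

(* At the solution, the partial sums of [m] are those of [y] plus [dual y m]:
   they form the taut string, and [dual y m] is its height in the tube. *)
Definition dual (N : nat) (y m : 'rV[R]_N) (t : nat) : R :=
  \sum_(1 <= s < t.+1) (entry m s - entry y s).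

(** Raising the first [t] entries by [h] alters at most one increment, so these perturbations yield
    the optimality conditions one index at a time. *)
Let step (N t : nat) (h : R) : 'rV[R]_N :=
  \row_(i < N) (if (i.+1 <= t)%N then h else 0).

Let entry_step (N t s : nat) (h : R) : (0 < s <= N)%N ->
  entry (step N t h) s = if (s <= t)%N then h else 0.
Proof.
case: s => // s /= sN.
by rewrite -[s]/(val (Ordinal sN)) entry_succ mxE.
Qed.

Lemma flsa_objective_step (N t : nat) (lam h : R) (y m : 'rV[R]_N) :
  (0 < t <= N)%N ->
  flsa_objective lam y (m + step N t h) - flsa_objective lam y m =
  h * dual y m t + 2^-1 * t%:R * h ^+ 2 +
  (if (t < N)%N then lam * (`|increment m t - h| - `|increment m t|) else 0).
Proof.
move=> /andP[t0 tN]; rewrite /flsa_objective.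
rewrite opprD addrACA -!mulrBr -!sumrB; congr (_ + _).
  rewrite (eq_big_nat _ _ (F2 := fun s => if (s <= t)%N then
      h ^+ 2 + 2 * h * (entry m s - entry y s) else 0)); last first.
    move=> s /andP[s0 sN]; rewrite entryD entry_step ?s0//.
    by case: ifP => _; ring.
  rewrite -big_mkcond/=.
  transitivity (2^-1 * \sum_(1 <= s < t.+1)
      (h ^+ 2 + 2 * h * (entry m s - entry y s))).
    by rewrite [in RHS](big_nat_widen _ _ N.+1).
  rewrite big_split/= sumr_const_nat subn1/= -mulr_sumr /dual.
  by rewrite -[h ^+ 2 *+ t]mulr_natr; field.
case: ifPn => tN'; last first.
  rewrite big_nat_cond big1 ?mulr0// => s /[!andbT] /andP[s2 sN].
  have -> : t = N by lia.
  rewrite !entryD !entry_step; [|lia..].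
  have -> : (s <= N)%N by lia.
  have -> : (s.-1 <= N)%N by lia.
  by rewrite opprD addrACA subrr addr0 subrr.
congr (_ * _).
rewrite (@big_cat_nat _ _ _ t.+1)//=.
rewrite [X in X + _]big_nat_cond big1 ?add0r; last first.
  move=> s /[!andbT] /andP[s2 sN].
  rewrite !entryD !entry_step; [|lia..].
  have -> : (s <= t)%N by lia.
  have -> : (s.-1 <= t)%N by lia.
  by rewrite opprD addrACA subrr addr0 subrr.
rewrite big_ltn//= [X in _ + X]big_nat_cond big1 ?addr0; last first.
  move=> s /[!andbT] /andP[s2 sN].
  rewrite !entryD !entry_step; [|lia..].
  have -> : (s <= t)%N = false by lia.
  have -> : (s.-1 <= t)%N = false by lia.
  by rewrite opprD addrACA subrr addr0 subrr.
rewrite !entryD !entry_step; [|lia..].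
by rewrite ltnn leqnn addr0 opprD addrA /increment.
Qed.

Let slope_ge0 (a b r : R) : 0 <= b -> 0 < r ->
  (forall h, 0 <= h <= r -> 0 <= h * a + b * h ^+ 2) -> 0 <= a.
Proof.
move=> b0 r0 H; rewrite leNgt; apply/negP => a0.
pose h := Num.min r (- a / (2 * (b + 1))).
have h0 : 0 < h by rewrite lt_min r0 divr_gt0; lra.
have hr : h <= r by rewrite ge_min lexx.
have hb : h * (2 * (b + 1)) <= - a.
  by rewrite -ler_pdivlMr ?ge_min ?lexx ?orbT//; lra.
have /H : 0 <= h <= r by rewrite ltW.
have : h * b <= - a / 2 by nra.
nra.
Qed.

(** [dual y m t] belongs to [lam] times the subdifferential of the absolute value at
    [increment m t]; its vanishing at [N] says that [m] and [y] have the same total. *)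
Definition kkt (N : nat) (lam : R) (y m : 'rV[R]_N) : Prop :=
  dual y m N = 0 /\
  forall t, (0 < t < N)%N ->
    [/\ `|dual y m t| <= lam,
        0 < increment m t -> dual y m t = lam &
        increment m t < 0 -> dual y m t = - lam].

(** Each condition expresses that a one-sided derivative along a step of height [h] or [- h] is
    nonnegative. Where the increment is nonzero, [h] is kept at most its size, so that the absolute
    value stays linear. *)
Lemma flsa_kkt (N : nat) (lam : R) (y m : 'rV[R]_N) : 0 <= lam ->
  flsa_solution lam y m -> kkt lam y m.
Proof.
move=> lam0 opt.
have step_ge0 t h : (0 < t <= N)%N -> 0 <= h * dual y m t + 2^-1 * t%:R * h ^+ 2 +
    (if (t < N)%N then lam * (`|increment m t - h| - `|increment m t|) else 0).
  by move=> tN; rewrite -flsa_objective_step// subr_ge0; exact: opt.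
split.
  have [N0|N0] := posnP N; first by rewrite /dual big_geq// N0.
  have {}step_ge0 h : 0 <= h * dual y m N + 2^-1 * N%:R * h ^+ 2.
    have := step_ge0 N h; rewrite N0 leqnn ltnn addr0; exact.
  have b0 : 0 <= 2^-1 * N%:R :> R by rewrite mulr_ge0.
  apply/eqP; rewrite eq_le; apply/andP; split.
    rewrite -oppr_ge0; apply: (@slope_ge0 _ (2^-1 * N%:R) 1) => // h _.
    by have := step_ge0 (- h); rewrite sqrrN mulNr mulrN.
  by apply: (@slope_ge0 _ (2^-1 * N%:R) 1) => // h _.
move=> t /andP[t0 tN].
have b0 : 0 <= 2^-1 * t%:R :> R by rewrite mulr_ge0.
have {}step_ge0 h : 0 <= h * dual y m t + 2^-1 * t%:R * h ^+ 2 +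
    lam * (`|increment m t - h| - `|increment m t|).
  have := step_ge0 t h; rewrite t0 (ltnW tN) tN; exact.
have tri h : `|increment m t - h| - `|increment m t| <= `|h|.
  by rewrite lerBlDl; exact: ler_normB.
have zle : dual y m t <= lam.
  rewrite -subr_ge0; apply: (@slope_ge0 _ (2^-1 * t%:R) 1) => // h /andP[h0 _].
  have := step_ge0 (- h); have := tri (- h); rewrite sqrrN normrN (ger0_norm h0).
  move=> /(ler_wpM2l lam0); nra.
have zge : - lam <= dual y m t.
  rewrite -subr_ge0 opprK; apply: (@slope_ge0 _ (2^-1 * t%:R) 1) => // h /andP[h0 _].
  have := step_ge0 h; have := tri h; rewrite (ger0_norm h0).
  move=> /(ler_wpM2l lam0); nra.
split=> [|x0|x0].
- by rewrite ler_norml zge.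
- apply/eqP; rewrite eq_le zle/= -subr_ge0.
  apply: (@slope_ge0 _ (2^-1 * t%:R) (increment m t)) => // h /andP[h0 hx].
  have := step_ge0 h; rewrite ger0_norm ?subr_ge0// gtr0_norm//; nra.
- apply/eqP; rewrite eq_le zge andbT -subr_ge0.
  apply: (@slope_ge0 _ (2^-1 * t%:R) (- increment m t)); rewrite ?oppr_gt0//.
  move=> h /andP[h0 hx].
  have := step_ge0 (- h); rewrite ler0_norm; last by lra.
  by rewrite ltr0_norm// sqrrN; nra.
Qed.

End optimality.

(** * Dependence of the solution on the data, and measurability *)

Section nonexpansive.
Context (R : realType).

Lemma dualS (N : nat) (y m : 'rV[R]_N) t :
  dual y m t.+1 = dual y m t + (entry m t.+1 - entry y t.+1).
Proof. by rewrite /dual big_nat_recr. Qed.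

Lemma dual0 (N : nat) (y m : 'rV[R]_N) : dual y m 0 = 0.
Proof. by rewrite /dual big_geq. Qed.

(** Monotonicity of the subdifferential of [lam |x|]. *)
Let monotone_subgradient (lam x x' z z' : R) :
  `|z| <= lam -> (0 < x -> z = lam) -> (x < 0 -> z = - lam) ->
  `|z'| <= lam -> (0 < x' -> z' = lam) -> (x' < 0 -> z' = - lam) ->
  0 <= (x - x') * (z - z').
Proof.
rewrite !ler_norml => /andP[za zb] zp zn /andP[za' zb'] zp' zn'.
have [xx|xx|->] := ltgtP x x'; last by rewrite subrr mul0r.
- have [x0|x0] := ltP x 0; first by have := zn x0; nra.
  by have := zp' (le_lt_trans x0 xx); nra.
- have [x0|x0] := ltP x' 0; first by have := zn' x0; nra.
  by have := zp (le_lt_trans x0 xx); nra.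
Qed.

(** Abel summation against the difference [w] of the dual vectors, which vanishes at both ends;
    monotonicity of the subdifferential gives the remaining terms a sign. Hence the sum of
    [D (D - E)] is at most 0, and [2 D E <= D ^ 2 + E ^ 2] concludes. *)
Lemma flsa_nonexpansive (N : nat) (lam : R) (y y' m m' : 'rV[R]_N) :
  0 <= lam -> flsa_solution lam y m -> flsa_solution lam y' m' ->
  \sum_(1 <= s < N.+1) (entry m s - entry m' s) ^+ 2 <=
  \sum_(1 <= s < N.+1) (entry y s - entry y' s) ^+ 2.
Proof.
move=> lam0 /(flsa_kkt lam0)[zN H] /(flsa_kkt lam0)[zN' H'].
pose D s := entry m s - entry m' s.
pose E s := entry y s - entry y' s.
pose w s := dual y m s - dual y' m' s.
have wS s : w s.+1 = w s + (D s.+1 - E s.+1).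
  by rewrite /w /D /E !dualS; ring.
have abel n : (n <= N)%N ->
    \sum_(1 <= s < n.+1) D s * (D s - E s) <= D n * w n.
  elim: n => [_|n IH nN]; first by rewrite big_geq// /w !dual0 subrr mulr0.
  rewrite big_nat_recr//= (le_trans (lerD (IH (ltnW nN)) (lexx _)))// wS.
  suff : 0 <= (D n.+1 - D n) * w n by nra.
  have [->|n0] := posnP n; first by rewrite /w !dual0 subr0 mulr0.
  have [|z1 z2 z3] := H n; first by rewrite n0.
  have [|z1' z2' z3'] := H' n; first by rewrite n0.
  have := monotone_subgradient z1 z2 z3 z1' z2' z3'.
  rewrite /D /w /increment; congr (0 <= _ * _); ring.
have := abel N (leqnn N); rewrite /w zN zN' subrr mulr0 => DE.
have : \sum_(1 <= s < N.+1) D s ^+ 2 <=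
    2^-1 * \sum_(1 <= s < N.+1) D s ^+ 2 + 2^-1 * \sum_(1 <= s < N.+1) E s ^+ 2.
  rewrite -mulrDr -big_split/= mulr_sumr -subr_le0 -sumrB.
  apply: le_trans DE; apply: ler_sum => s _.
  by have := sqr_ge0 (D s - E s); nra.
rewrite -/(D _); set a := \sum_(_ <= s < _) D s ^+ 2.
set b := \sum_(_ <= s < _) E s ^+ 2; lra.
Qed.

End nonexpansive.

(** [{G < a}] is a countable union of boxes with rational centre in the coordinates [X]. Working
    with preimages in [T] avoids factoring [G] through a function on the range of [X]. *)
Lemma measurable_fun_uniform (R : realType) d (T : measurableType d) (N : nat)
    (X : 'I_N -> T -> R) (G : T -> R) :
  (forall i, measurable_fun setT (X i)) ->
  (forall eta : R, 0 < eta -> exists2 r : R, 0 < r &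
    forall w w', (forall i, `|X i w - X i w'| < r) -> `|G w - G w'| < eta) ->
  measurable_fun setT G.
Proof.
move=> mX cG.
apply: (measurability _ (RGenInftyO.measurableE R)) => //.
move=> _ [_ [a ->] <-]; rewrite setTI.
pose box (p : {ffun 'I_N -> rat} * nat) : set T :=
  \bigcap_i [set w | `|X i w - ratr (p.1 i)| < p.2.+1%:R^-1].
have mbox p : measurable (box p).
  apply: fin_bigcap_measurable => [|i _]; first exact: finite_finset.
  pose Y w := `|X i w - ratr (p.1 i)|.
  have mY : measurable_fun setT Y.
    by apply: measurableT_comp => //; exact: measurable_funB.
  rewrite (_ : [set _ | _] = setT `&` Y @^-1` `]-oo, p.2.+1%:R^-1[).
    by apply: mY => //; exact: measurable_itv.
  by rewrite setTI; apply/seteqP; split => w /=; rewrite in_itv.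
pose A := G @^-1` `]-oo, a[.
(* Pairs of centre and radius are enumerated; a box not contained in [A] contributes the empty
   set. *)
pose F n := if unpickle n is Some p then
  (if `[< box p `<=` A >] then box p else set0) else set0.
rewrite (_ : _ @^-1` _ = \bigcup_n F n); last first.
  apply/seteqP; split=> [w|w [n _]]; last first.
    by rewrite /F; case: unpickle => // p; case: asboolP => // boxA /boxA.
  rewrite /= in_itv/= => Gw.
  have [|r r0 rG] := cG (a - G w); first by rewrite subr_gt0.
  pose k := Num.truncn (2 / r).
  have kr : k.+1%:R^-1 < r / 2.
    rewrite -[ltRHS]invf_div ltf_pV2 ?posrE ?divr_gt0//.
    exact: truncnS_gt.
  have /choice[q qP] : forall i, exists q : rat, `|X i w - ratr q| < k.+1%:R^-1.
    move=> i.
    have [|q] := @rat_in_itvoo R (X i w - k.+1%:R^-1) (X i w + k.+1%:R^-1).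
      by rewrite ltrBlDr -addrA ltrDl addr_gt0// invr_gt0.
    rewrite in_itv/= => /andP[q1 q2]; exists q.
    by rewrite distrC ltr_distl q1.
  pose p := ([ffun i => q i], k).
  exists (pickle p) => //; rewrite /F pickleK.
  have wp : box p w by move=> i _ /=; rewrite ffunE; exact: qP.
  rewrite asboolT// => w' w'p; rewrite /A/= in_itv/=.
  have : `|G w - G w'| < a - G w.
    apply: rG => i.
    have h1 := wp i I; have h2 := w'p i I; rewrite /= in h1 h2.
    rewrite (le_lt_trans (ler_distD (ratr (p.1 i)) _ _))//.
    rewrite [r]splitr ltrD ?(lt_trans h1)// distrC (lt_trans h2)//.
  by rewrite ltr_norml; lra.
apply: bigcup_measurable => n _; rewrite /F.
by case: unpickle => [p|//]; case: ifP.
Qed.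

Lemma measurable_entry_flsa (R : realType) d (T : measurableType d) (N : nat)
    (X : 'I_N -> T -> R) (m0 : 'rV[R]_N) (lam : R) (mhat : T -> 'rV[R]_N) (t : nat) :
  0 <= lam -> (forall i, measurable_fun setT (X i)) ->
  (forall w, flsa_solution lam (m0 + \row_i X i w) (mhat w)) ->
  measurable_fun setT (fun w => entry (mhat w) t).
Proof.
move=> lam0 mX opt; apply: (measurable_fun_uniform mX) => eta eta0.
(* The [N] squared changes then sum to less than [eta ^ 2], and the squared change of any entry of
   the solution is at most this sum. *)
exists (eta / N.+1%:R); first by rewrite divr_gt0.
move=> w w' ww'.
have eta2 : \sum_(1 <= s < N.+1)
    (entry (mhat w) s - entry (mhat w') s) ^+ 2 < eta ^+ 2.
  apply: le_lt_trans (flsa_nonexpansive lam0 (opt w) (opt w')) _.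
  apply: (@le_lt_trans _ _ (\sum_(1 <= s < N.+1) (eta / N.+1%:R) ^+ 2)).
    rewrite big_nat_cond [leRHS]big_nat_cond.
    apply: ler_sum => -[//|s] /[!andbT] /= sN.
    have sN' : (s < N)%N by lia.
    rewrite !entryD -[s]/(val (Ordinal sN')) !entry_succ !mxE.
    rewrite [X in X ^+ 2](_ : _ = X (Ordinal sN') w - X (Ordinal sN') w'); last by ring.
    rewrite -[leLHS]real_normK ?num_real// lerXn2r ?nnegrE//.
      by rewrite divr_ge0// ltW.
    exact/ltW/ww'.
  rewrite sumr_const_nat subn1/= -[X in X < _]mulr_natr expr_div_n.
  rewrite -mulrA gtr_pMr ?exprn_gt0// mulrC ltr_pdivrMr ?exprn_gt0// mul1r.
  by rewrite -natrX ltr_nat; nia.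
have [tN|tN] := leqP t N; last first.
  rewrite /entry; case: insubP => [i /= it _|]; last by rewrite subrr normr0.
  by exfalso; move: it; lia.
(* [entry] takes the same value at 0 and at 1. *)
wlog t0 : t tN / (0 < t)%N.
  have [->|t0] := posnP t; last by apply.
  have [N0|N0] := posnP N; last by move/(_ 1%N N0 isT); rewrite /entry.
  by rewrite /entry; case: insubP => [[i] /=|]; [lia|rewrite subrr normr0].
rewrite -ltr_sqr ?nnegrE ?(ltW eta0)// real_normK ?num_real//.
apply: le_lt_trans eta2.
rewrite (bigD1_seq t)/= ?mem_index_iota ?iota_uniq ?t0//.
by rewrite lerDl sumr_ge0// => s _; exact: sqr_ge0.
Qed.

(** * Slopes of the string next to its contact points *)

Section taut_string.
Context (R : realType).

Lemma incrementN (N : nat) (m : 'rV[R]_N) t : increment (- m) t = - increment m t.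
Proof. by rewrite /increment !entryN opprD. Qed.

Lemma dualN (N : nat) (y m : 'rV[R]_N) t : dual (- y) (- m) t = - dual y m t.
Proof.
by rewrite /dual -sumrN; apply: eq_bigr => s _; rewrite !entryN; ring.
Qed.

(** Negation exchanges the two obstacles, so that statements about descents follow from those about
    ascents. *)
Lemma kktN (N : nat) (lam : R) (y m : 'rV[R]_N) :
  kkt lam y m -> kkt lam (- y) (- m).
Proof.
move=> [zN H]; split; first by rewrite dualN zN oppr0.
move=> t /H[z1 z2 z3]; rewrite dualN normrN incrementN oppr_lt0 oppr_gt0.
by split=> // [/z3 ->|/z2 ->]; rewrite ?opprK.
Qed.

Lemma kkt_dual_le (N : nat) (lam : R) (y m : 'rV[R]_N) t : 0 <= lam ->
  kkt lam y m -> (t <= N)%N -> `|dual y m t| <= lam.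
Proof.
move=> lam0 [zN H] tN; have [->|t0] := posnP t; first by rewrite dual0 normr0.
move: tN; rewrite leq_eqVlt => /orP[/eqP tN|tN]; last by have [|//] := H t; rewrite t0.
by subst t; rewrite zN normr0.
Qed.

Definition noise_bounded (N : nat) (delta : R) (y m0 : 'rV[R]_N) : Prop :=
  forall a b, (a <= b <= N)%N ->
    `|\sum_(a.+1 <= s < b.+1) (entry y s - entry m0 s)| <= delta.

Lemma noise_boundedN (N : nat) (delta : R) (y m0 : 'rV[R]_N) :
  noise_bounded delta y m0 -> noise_bounded delta (- y) (- m0).
Proof.
move=> H a b /H; rewrite -[X in X <= _ -> _]normrN -sumrN.
rewrite (eq_bigr (fun s => entry (- y) s - entry (- m0) s))// => s _.
by rewrite !entryN; ring.
Qed.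

Lemma sum_entry_dual (N : nat) (y m : 'rV[R]_N) a b : (a <= b)%N ->
  \sum_(a.+1 <= s < b.+1) (entry m s - entry y s) = dual y m b - dual y m a.
Proof.
move=> ab; rewrite /dual [in RHS](@big_cat_nat _ _ _ a.+1)//=.
by rewrite [RHS]addrC addKr.
Qed.

(** [m - c] splits into [m - y], whose sum is a difference of values of [dual], the noise [y - m0],
    and [m0 - c], which is nonnegative. *)
Lemma sum_entry_ge (N : nat) (c delta : R) (y m m0 : 'rV[R]_N) a b :
  noise_bounded delta y m0 -> (a <= b <= N)%N ->
  (forall s, (a < s <= b)%N -> c <= entry m0 s) ->
  dual y m b - dual y m a - delta <= \sum_(a.+1 <= s < b.+1) (entry m s - c).
Proof.
move=> H /andP[ab bN] m0c.
have := H a b; rewrite ab bN => /(_ isT); rewrite ler_norml => /andP[ny _].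
have m0c' : 0 <= \sum_(a.+1 <= s < b.+1) (entry m0 s - c).
  rewrite big_nat_cond sumr_ge0// => s /[!andbT] /andP[s1 s2].
  by rewrite subr_ge0 m0c// s1.
have -> : \sum_(a.+1 <= s < b.+1) (entry m s - c) =
    \sum_(a.+1 <= s < b.+1) (entry m s - entry y s) +
    \sum_(a.+1 <= s < b.+1) (entry y s - entry m0 s) +
    \sum_(a.+1 <= s < b.+1) (entry m0 s - c).
  by rewrite -!big_split/=; apply: eq_bigr => s _; ring.
by rewrite sum_entry_dual//; lra.
Qed.

Lemma sum_entry_le (N : nat) (c delta : R) (y m m0 : 'rV[R]_N) a b :
  noise_bounded delta y m0 -> (a <= b <= N)%N ->
  (forall s, (a < s <= b)%N -> entry m0 s <= c) ->
  \sum_(a.+1 <= s < b.+1) (entry m s - c) <= dual y m b - dual y m a + delta.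
Proof.
move=> /noise_boundedN H ab m0c.
have := @sum_entry_ge N (- c) delta (- y) (- m) (- m0) a b H ab.
rewrite !dualN (eq_bigr (fun s => - (entry m s - c))); last first.
  by move=> s _; rewrite entryN; ring.
rewrite sumrN => H'; have {}H' := H' _; lapply H'; first by lra.
by move=> s /m0c; rewrite entryN lerN2.
Qed.

(** The run leftwards from [k] stops at [a] or at the last descent, where the optimality conditions
    put the string on the lower obstacle. On the run [m] does not decrease. *)
Lemma increasing_run_left (N : nat) (m : 'rV[R]_N) a k : (a < k)%N ->
  exists2 a', (a <= a' < k)%N &
    (a' = a \/ (a < a')%N /\ increment m a' < 0) /\
    forall s, (a' < s <= k)%N -> entry m s <= entry m k.
Proof.
elim: k => // k IH; rewrite ltnS leq_eqVlt => /orP[/eqP <-|ak].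
  exists a; first by lia.
  split; first by left.
  by move=> s sa; have -> : s = a.+1 by lia.
have [xk|xk] := ltP (increment m k) 0.
  exists k; first by lia.
  split; first by right.
  by move=> s sk; have -> : s = k.+1 by lia.
have [a' /andP[aa' a'k] [anchor mon]] := IH ak.
exists a'; first by lia.
split=> // s /andP[a's]; rewrite leq_eqVlt => /orP[/eqP -> //|sk].
rewrite (le_trans (mon s _)) ?a's//.
by move: xk; rewrite /increment subr_ge0.
Qed.

Lemma increasing_run_right (N : nat) (m : 'rV[R]_N) k b : (k < b)%N ->
  exists2 b', (k < b' <= b)%N &
    (b' = b \/ (b' < b)%N /\ increment m b' < 0) /\
    forall s, (k < s <= b')%N -> entry m k.+1 <= entry m s.
Proof.
(* The right end moves while [k] is fixed, so the induction is on the length of the window. *)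
move=> kb; suff H n : (n <= b - k.+1)%N -> exists2 b', (k < b' <= k.+1 + n)%N &
    (b' = (k.+1 + n)%N \/ (b' < k.+1 + n)%N /\ increment m b' < 0) /\
    forall s, (k < s <= b')%N -> entry m k.+1 <= entry m s.
  by have := H _ (leqnn _); rewrite subnKC.
elim: n => [_|n IH nb].
  rewrite addn0; exists k.+1; first by lia.
  split; first by left.
  by move=> s sk; have -> : s = k.+1 by lia.
have [b' /andP[kb' b'n] [anchor mon]] := IH (ltnW nb).
have [xb|xb] := ltP (increment m b') 0.
  exists b'; first by lia.
  by split=> //; right; split=> //; rewrite addnS ltnS.
case: anchor => [b'E|[_]]; last by rewrite ltNge xb.
exists b'.+1; first by lia.
split; first by left; rewrite b'E addnS.
move=> s /andP[ks]; rewrite leq_eqVlt => /orP[/eqP ->|sb']; last first.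
  by apply: mon; rewrite ks.
rewrite (le_trans (mon b' _)) ?kb' ?leqnn//.
by move: xb; rewrite /increment subr_ge0.
Qed.

Section kink.
Context (N : nat) (lam delta c : R) (y m m0 : 'rV[R]_N).
Hypotheses (Hkkt : kkt lam y m) (Hnoise : noise_bounded delta y m0).

(* [k] is a contact point with the upper obstacle: going left from [k] until
   the last descent of [m], the string cannot be steeper than [m_k]. *)
Lemma contact_left a k : (a < k < N)%N -> dual y m k = lam ->
  (forall s, (a < s <= k)%N -> c <= entry m0 s) ->
  exists2 a', (a <= a' < k)%N & (a' = a \/ dual y m a' = - lam) /\
    lam - dual y m a' - delta <= (k - a')%:R * (entry m k - c).
Proof.
move=> /andP[ak kN] zk m0c.
have [a' /andP[aa' a'k] [anchor mon]] := increasing_run_left m ak.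
exists a'; first by rewrite aa'.
split.
  case: anchor => [|[aa xa]]; [by left|right].
  by have [|_ _ ->] := Hkkt.2 a' => //; lia.
rewrite -zk (le_trans (@sum_entry_ge _ c _ _ _ _ a' k Hnoise _ _))//.
- lia.
- by move=> s /andP[s1 s2]; apply: m0c; lia.
rewrite [leRHS](_ : _ = \sum_(a'.+1 <= s < k.+1) (entry m k - c)); last first.
  by rewrite sumr_const_nat subSS mulr_natl.
rewrite big_nat_cond [leRHS]big_nat_cond; apply: ler_sum => s /[!andbT] sk.
by rewrite lerD2r mon//; lia.
Qed.

(** Counterpart after the contact: going right until the next descent, the string is at least as
    steep as [m_(k+1)], and [c] now bounds the signal from above. *)
Lemma contact_right k b : (k < b <= N)%N -> dual y m k = lam ->
  (forall s, (k < s <= b)%N -> entry m0 s <= c) ->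
  exists2 b', (k < b' <= b)%N & (b' = b \/ dual y m b' = - lam) /\
    (b' - k)%:R * (entry m k.+1 - c) <= dual y m b' - lam + delta.
Proof.
move=> /andP[kb bN] zk m0c.
have [b' /andP[kb' b'b] [anchor mon]] := increasing_run_right m kb.
exists b'; first by rewrite kb'.
split.
  case: anchor => [|[aa xa]]; [by left|right].
  by have [|_ _ ->] := Hkkt.2 b' => //; lia.
rewrite -zk (le_trans _ (@sum_entry_le _ c _ _ _ _ k b' Hnoise _ _))//.
- rewrite [leLHS](_ : _ = \sum_(k.+1 <= s < b'.+1) (entry m k.+1 - c)); last first.
    by rewrite sumr_const_nat subSS mulr_natl.
  rewrite big_nat_cond [leRHS]big_nat_cond; apply: ler_sum => s /[!andbT] sk.
  by rewrite lerD2r mon//; lia.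
- lia.
- by move=> s /andP[s1 s2]; apply: m0c; lia.
Qed.

End kink.
End taut_string.

(** * Exclusion and existence of kinks *)

Section segment.
Context (R : realType) (N : nat).

(** An ascent at [k] is a contact with the upper obstacle. To the right the string falls to height
    at most 0 within [N] steps, so [m_(k+1) <= c - (lam - delta) / N]. To the left it rises from
    height at most 0 or the run is at least [rho] long, so [m_k >= c - delta / rho]. As
    [delta N < rho (lam - delta)], [m_k] would exceed [m_(k+1)]. *)
Let no_ascent (lam delta rho c : R) (y m m0 : 'rV[R]_N) (i k b0 : nat) :
  0 <= delta < lam -> 0 < rho -> delta * N%:R < rho * (lam - delta) ->
  kkt lam y m -> noise_bounded delta y m0 ->
  (i < k < N)%N -> (k < b0 <= N)%N ->
  (forall s, (i < s <= k)%N -> c <= entry m0 s) ->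
  (forall s, (k < s <= b0)%N -> entry m0 s <= c) ->
  dual y m b0 <= 0 ->
  dual y m i = 0 \/ rho <= k%:R - i%:R ->
  increment m k <= 0.
Proof.
move=> /andP[d0 dlam] rho0 rhoN Hkkt Hnoise /andP[ik kN] /andP[kb bN] mge mle zb anchor.
have lam0 : 0 <= lam by lra.
rewrite leNgt; apply/negP => xk.
have zk : dual y m k = lam.
  by have [|_ -> //] := Hkkt.2 k; rewrite kN andbT (leq_ltn_trans _ ik).
have [|a' /andP[ia a'k] [a'E L]] := contact_left Hkkt Hnoise _ zk mge.
  by rewrite ik.
have [|b' /andP[kb' b'b] [b'E Rr]] := contact_right Hkkt Hnoise _ zk mle.
  by rewrite kb.
have k1 : entry m k < entry m k.+1 by rewrite -subr_gt0.
have zb' : dual y m b' <= 0 by case: b'E => ->//; lra.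
have {}Rr : N%:R * (entry m k.+1 - c) <= - (lam - delta).
  have : (b' - k)%:R <= N%:R :> R.
    by rewrite ler_nat (leq_trans (leq_subr _ _))// (leq_trans b'b).
  have : 0 <= (b' - k)%:R :> R by [].
  move: Rr zb'; set n := (b' - k)%:R; set v := _ - c; move=> Rr zb' n0 nN.
  have v0 : v <= 0 by rewrite leNgt; apply/negP => v0; have := mulr_ge0 n0 (ltW v0); lra.
  have : N%:R * v <= n * v by rewrite ler_wnM2r.
  lra.
have {}L : - delta <= rho * (entry m k - c).
  have ka0 : 0 < (k - a')%:R :> R by rewrite ltr0n subn_gt0.
  have [|za] := leP (dual y m a') 0 => [za|].
    have : 0 <= (k - a')%:R * (entry m k - c) by lra.
    by rewrite pmulr_rge0// => h; have := mulr_ge0 (ltW rho0) h; lra.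
  case: a'E => [a'i|a'E]; last by move: za; rewrite a'E; lra.
  case: anchor => [zi|ri]; first by move: za; rewrite a'i zi ltxx.
  have : rho <= (k - a')%:R by rewrite natrB ?(ltnW a'k)// a'i.
  have a'N : (a' <= N)%N by rewrite ltnW// (ltn_trans a'k).
  have := kkt_dual_le lam0 Hkkt a'N; rewrite ler_norml => /andP[_ zle] rk.
  have [v0|v0] := leP 0 (entry m k - c).
    by have := mulr_ge0 (ltW rho0) v0; lra.
  by have := ler_wnM2r (ltW v0) rk; lra.
have N0 : 0 < N%:R :> R by rewrite ltr0n (leq_ltn_trans _ kN).
have : N%:R * (rho * (entry m k - c)) < N%:R * (rho * (entry m k.+1 - c)).
  by rewrite ltr_pM2l// ltr_pM2l// ltrD2r.
have := ler_wpM2l (ltW N0) L; have := ler_wpM2l (ltW rho0) Rr; lra.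
Qed.

(** The same argument in reversed time, with a rise to the left of [k] in place of the fall:
    [m_k >= c + (lam - delta) / N] and [m_(k+1) <= c + delta / rho]. *)
Let no_ascent' (lam delta rho c : R) (y m m0 : 'rV[R]_N) (a0 k j : nat) :
  0 <= delta < lam -> 0 < rho -> delta * N%:R < rho * (lam - delta) ->
  kkt lam y m -> noise_bounded delta y m0 ->
  (a0 < k)%N -> (k < j <= N)%N -> (k < N)%N ->
  (forall s, (a0 < s <= k)%N -> c <= entry m0 s) ->
  (forall s, (k < s <= j)%N -> entry m0 s <= c) ->
  dual y m a0 <= 0 ->
  dual y m j = 0 \/ rho <= j%:R - k%:R ->
  increment m k <= 0.
Proof.
move=> /andP[d0 dlam] rho0 rhoN Hkkt Hnoise ak /andP[kj jN] kN mge mle za anchor.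
have lam0 : 0 <= lam by lra.
rewrite leNgt; apply/negP => xk.
have zk : dual y m k = lam.
  by have [|_ -> //] := Hkkt.2 k; rewrite kN andbT (leq_ltn_trans _ ak).
have [|a' /andP[aa' a'k] [a'E L]] := contact_left Hkkt Hnoise _ zk mge.
  by rewrite ak.
have [|b' /andP[kb' b'j] [b'E Rr]] := contact_right Hkkt Hnoise _ zk mle.
  by rewrite kj.
have k1 : entry m k < entry m k.+1 by rewrite -subr_gt0.
have za' : dual y m a' <= 0 by case: a'E => ->//; lra.
have {}L : lam - delta <= N%:R * (entry m k - c).
  have : (k - a')%:R <= N%:R :> R by rewrite ler_nat (leq_trans (leq_subr _ _))// ltnW.
  have : 0 <= (k - a')%:R :> R by [].
  move: L za'; set n := (k - a')%:R; set v := _ - c; move=> L za' n0 nN.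
  have v0 : 0 <= v.
    rewrite leNgt; apply/negP => v0.
    by have := ler_wnM2r (ltW v0) n0; rewrite mul0r; lra.
  have : n * v <= N%:R * v by rewrite ler_wpM2r.
  lra.
have {}Rr : rho * (entry m k.+1 - c) <= delta.
  have kb0 : 0 < (b' - k)%:R :> R by rewrite ltr0n subn_gt0.
  have [v0|v0] := leP (entry m k.+1 - c) 0.
    by rewrite (le_trans _ d0)// mulr_ge0_le0// ltW.
  have := mulr_gt0 kb0 v0.
  case: b'E => [b'j'|zb']; last by rewrite zb' in Rr; lra.
  move: Rr v0 kb0; rewrite b'j' => Rr v0 kb0.
  case: anchor => [zj|rk _]; first by rewrite zj in Rr; lra.
  have {}rk : rho <= (j - k)%:R by rewrite natrB// ltnW.
  have := kkt_dual_le lam0 Hkkt jN; rewrite ler_norml => /andP[_ zle].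
  apply: le_trans (ler_wpM2r (ltW v0) rk) _; lra.
have N0 : 0 < N%:R :> R by rewrite ltr0n (leq_ltn_trans _ kN).
have : N%:R * (rho * (entry m k - c)) < N%:R * (rho * (entry m k.+1 - c)).
  by rewrite ltr_pM2l// ltr_pM2l// ltrD2r.
have := ler_wpM2l (ltW N0) Rr; have := ler_wpM2l (ltW rho0) L; lra.
Qed.

(* On the segment [(i, j]] the signal has a local maximum [c]. The string has to
   descend through the whole tube between [a0] and [b0], so its slope is below
   [c] by about [lam / N], while near an extra kink it would be at least [c] up
   to the noise. *)
Lemma flat_inside_peak (lam delta rho c : R) (y m m0 : 'rV[R]_N)
    (a0 i k j b0 : nat) :
  0 <= delta < lam -> 0 < rho -> delta * N%:R < rho * (lam - delta) ->
  kkt lam y m -> noise_bounded delta y m0 ->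
  (a0 < k < b0)%N -> (b0 <= N)%N -> (i < k < j)%N -> (j <= N)%N ->
  (forall s, (i < s <= j)%N -> entry m0 s = c) ->
  (forall s, (a0 < s <= b0)%N -> entry m0 s <= c) ->
  0 <= dual y m a0 -> dual y m b0 <= 0 ->
  dual y m i = 0 \/ rho <= k%:R - i%:R ->
  dual y m j = 0 \/ rho <= j%:R - k%:R ->
  increment m k = 0.
Proof.
move=> hd rho0 rhoN Hkkt Hnoise /andP[ak kb] bN /andP[ik kj] jN m0c m0le za zb anchi anchj.
apply/eqP; rewrite eq_le; apply/andP; split.
  apply: (@no_ascent lam delta rho c y m m0 i k b0) => //.
  - by rewrite ik (leq_trans kj).
  - by rewrite kb.
  - by move=> s /andP[s1 s2]; rewrite m0c// s1 (leq_trans s2)// ltnW.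
  - by move=> s /andP[s1 s2]; rewrite m0le// s2 (ltn_trans ak).
(* A descent is an ascent for the negated data, whose string rises from height at most 0 at [a0]. *)
rewrite -oppr_le0 -incrementN.
apply: (@no_ascent' lam delta rho (- c) (- y) (- m) (- m0) a0 k j) => //.
- exact: kktN.
- exact: noise_boundedN.
- by rewrite kj.
- exact: leq_trans jN.
- by move=> s /andP[s1 s2]; rewrite entryN lerN2 m0le// s1 (leq_trans s2)// ltnW.
- by move=> s /andP[s1 s2]; rewrite entryN lerN2 m0c// s2 (ltn_trans ik).
- by rewrite dualN oppr_le0.
- by case: anchj => [zj|]; [left; rewrite dualN zj oppr0|right].
Qed.

(* If [m] did not increase on the window, its means over the two halves would
   be ordered the wrong way; they are within [(2 lam + delta) / r] of the
   levels [u < v] of [m0]. *)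
Lemma ascent_near_up_jump (lam delta u v : R) (y m m0 : 'rV[R]_N) (i r : nat) :
  0 <= lam -> kkt lam y m -> noise_bounded delta y m0 ->
  (0 < r <= i)%N -> (i + r <= N)%N ->
  (forall s, (i - r < s <= i)%N -> entry m0 s = u) ->
  (forall s, (i < s <= i + r)%N -> entry m0 s = v) ->
  4 * lam + 2 * delta < r%:R * (v - u) ->
  exists2 k, (i - r < k < i + r)%N & 0 < increment m k.
Proof.
move=> lam0 Hkkt Hnoise /andP[r0 ri] irN m0u m0v gap.
have iN := leq_trans (leq_addr r i) irN.
have [//|noinc] := pselect (exists2 k, (i - r < k < i + r)%N & 0 < increment m k).
have {noinc}dec k : (i - r < k < i + r)%N -> entry m k.+1 <= entry m k.
  move=> hk; rewrite -subr_le0 leNgt; apply/negP => xk.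
  by apply: noinc; exists k.
have decl n : (n < r)%N -> entry m i <= entry m (i - n)%N.
  elim: n => [_|n IH nr]; first by rewrite subn0.
  rewrite (le_trans (IH (ltnW nr)))//.
  have -> : (i - n)%N = (i - n.+1).+1 by lia.
  by apply: dec; lia.
have decr n : (n < r)%N -> entry m (i + n.+1)%N <= entry m i.+1.
  elim: n => [_|n IH nr]; first by rewrite addn1.
  by rewrite (le_trans _ (IH (ltnW nr)))// addnS dec//; lia.
have L : r%:R * (entry m i - u) <= 2 * lam + delta.
  have h1 : (i - r <= i <= N)%N by lia.
  have H : \sum_((i - r).+1 <= s < i.+1) (entry m s - u) <=
      dual y m i - dual y m (i - r)%N + delta.
    by apply: (sum_entry_le m Hnoise h1) => s /m0u ->.
  have := kkt_dual_le lam0 Hkkt iN; rewrite ler_norml => /andP[_ zi].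
  have := kkt_dual_le lam0 Hkkt (leq_trans (leq_subr r i) iN).
  rewrite ler_norml => /andP[zir _].
  suff : r%:R * (entry m i - u) <= \sum_((i - r).+1 <= s < i.+1) (entry m s - u) by lra.
  rewrite [leLHS](_ : _ = \sum_((i - r).+1 <= s < i.+1) (entry m i - u)); last first.
    by rewrite sumr_const_nat subSS subKn// mulr_natl.
  rewrite big_nat_cond [leRHS]big_nat_cond; apply: ler_sum => s /[!andbT] hs.
  rewrite lerD2r (_ : s = i - (i - s))%N; last by lia.
  by apply: decl; lia.
have Rr : - (2 * lam + delta) <= r%:R * (entry m i.+1 - v).
  have h1 : (i <= i + r <= N)%N by lia.
  have H : dual y m (i + r)%N - dual y m i - delta <=
      \sum_(i.+1 <= s < (i + r).+1) (entry m s - v).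
    by apply: (sum_entry_ge m Hnoise h1) => s /m0v ->.
  have := kkt_dual_le lam0 Hkkt iN; rewrite ler_norml => /andP[_ zi].
  have := kkt_dual_le lam0 Hkkt irN.
  rewrite ler_norml => /andP[zir _].
  suff : \sum_(i.+1 <= s < (i + r).+1) (entry m s - v) <= r%:R * (entry m i.+1 - v) by lra.
  rewrite [leRHS](_ : _ = \sum_(i.+1 <= s < (i + r).+1) (entry m i.+1 - v)); last first.
    by rewrite sumr_const_nat subSS addKn mulr_natl.
  rewrite big_nat_cond [leRHS]big_nat_cond; apply: ler_sum => s /[!andbT] hs.
  rewrite lerD2r (_ : s = i + (s - i.+1).+1)%N; last by lia.
  by apply: decr; lia.
have : entry m i.+1 <= entry m i by apply: dec; lia.
rewrite -subr_ge0 => h; have := mulr_ge0 (ler0n R r) h; lra.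
Qed.

End segment.

(** * Segments of the true signal *)

Lemma index_iota_bounds n : (0 < n)%N ->
  index_iota 1 n.+2 = 1%N :: rcons (index_iota 2 n.+1) n.+1.
Proof.
case: n => // n _; rewrite /index_iota !subSS !subn0 -cats1.
by rewrite -[in LHS](addn1 n) -addSn iotaD add1n.
Qed.

Section segments.
Context (R : realType) (N : nat) (m : 'rV[R]_N).
Hypothesis N0 : (0 < N)%N.

Let bps : seq nat := 1%N :: rcons (change_points m) N.+1.

Let is_bp t := [|| t == 1%N, t == N.+1 | entry m t != entry m t.-1].

(** As a filter of an interval, the list of break points is sorted and membership in it is a boolean
    test; the ends 1 and [N + 1] are forced in. *)
Let bpsE : bps = [seq t <- index_iota 1 N.+2 | is_bp t].
Proof.
rewrite index_iota_bounds//= filter_rcons {1}/is_bp eqxx orbT.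
rewrite /bps /change_points; congr (_ :: rcons _ _).
apply: eq_in_filter => t; rewrite mem_index_iota => /andP[t2 tN].
by rewrite /is_bp gtn_eqF// ltn_eqF.
Qed.

Let size_bps : size bps = (nsegments m).+1.
Proof. by rewrite /bps /= size_rcons. Qed.

Let sorted_bps : sorted ltn bps.
Proof. by rewrite bpsE sorted_filter ?iota_ltn_sorted//; exact: ltn_trans. Qed.

Lemma cpt0 : cpt m 0 = 1%N.
Proof. by []. Qed.

Lemma cpt_nsegments : cpt m (nsegments m) = N.+1.
Proof. by rewrite /cpt /nsegments /= nth_rcons ltnn eqxx. Qed.

Lemma cpt_lt q q' : (q < q')%N -> (q' <= nsegments m)%N -> (cpt m q < cpt m q')%N.
Proof.
move=> qq' q'M; rewrite /cpt.
apply: (sorted_ltn_nth ltn_trans 0%N sorted_bps) => //; rewrite inE size_bps ltnS//.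
by rewrite (leq_trans _ q'M)// ltnW.
Qed.

Lemma cpt_le q q' : (q <= q')%N -> (q' <= nsegments m)%N -> (cpt m q <= cpt m q')%N.
Proof.
rewrite leq_eqVlt => /orP[/eqP -> //|qq'] q'M.
by rewrite ltnW// cpt_lt.
Qed.

(** A jump strictly inside would be a break point between two consecutive ones. *)
Lemma entry_segment q s : (0 < q <= nsegments m)%N ->
  (cpt m q.-1 <= s < cpt m q)%N -> entry m s = entry m (cpt m q.-1).
Proof.
move=> /andP[q0 qM]; elim: s => [|s IH] /andP[s1 s2].
  by move: s1; rewrite leqn0 => /eqP ->.
move: s1; rewrite leq_eqVlt => /orP[/eqP -> //|s1].
rewrite -IH; last by rewrite -ltnS s1 ltnW.
apply/eqP/negPn/negP => sjump.
have sin : s.+1 \in bps.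
  rewrite bpsE mem_filter /is_bp sjump !orbT mem_index_iota /= ltnS.
  by rewrite (leq_trans (ltnW s2))// -cpt_nsegments cpt_le.
have jlt : (index s.+1 bps < (nsegments m).+1)%N by rewrite -size_bps index_mem.
have jE : cpt m (index s.+1 bps) = s.+1 by rewrite /cpt nth_index.
have [jq|jq] := leqP q (index s.+1 bps).
  by have := cpt_le jq jlt; rewrite jE leqNgt s2.
have : (index s.+1 bps <= q.-1)%N by rewrite -ltnS prednK.
move=> /cpt_le /(_ (leq_trans (leq_pred _) qM)); rewrite jE.
by rewrite leqNgt s1.
Qed.

Lemma mem_segment k : (0 < k <= N)%N -> exists2 q,
  (0 < q <= nsegments m)%N & (cpt m q.-1 <= k < cpt m q)%N.
Proof.
move=> /andP[k0 kN].
have hk : has (fun t => k < t)%N bps.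
  by apply/hasP; exists N.+1; rewrite ?ltnS// /bps inE mem_rcons inE eqxx orbT.
pose q := find (fun t => k < t)%N bps.
have kq : (k < cpt m q)%N := nth_find 0%N hk.
have q0 : (0 < q)%N.
  by rewrite lt0n; apply/eqP => q0; move: kq; rewrite q0 cpt0 ltnS leqn0 gtn_eqF.
have qM : (q <= nsegments m)%N by rewrite -ltnS -size_bps -has_find.
exists q; first by rewrite q0.
rewrite kq andbT leqNgt; apply/negP => kq'.
by have := @before_find _ 0%N (fun t => k < t)%N bps q.-1; rewrite ltn_predL q0 kq' => /(_ isT).
Qed.

(** Passes from jumps between neighbours, which are bounded below, to jumps between segment levels,
    whose signs alternate. *)
Lemma increment_cpt q : (0 < q < nsegments m)%N ->
  increment m (cpt m q).-1 = entry m (cpt m q) - entry m (cpt m q.-1).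
Proof.
move=> /andP[q0 qM].
have c0 : (cpt m q.-1 < cpt m q)%N by rewrite cpt_lt ?ltn_predL// ltnW.
rewrite /increment prednK ?(leq_ltn_trans _ c0)//; congr (_ - _).
apply: entry_segment; first by rewrite q0 ltnW.
by move: c0; case: (cpt m q) => // c; rewrite ltnS => ->; rewrite leqnn.
Qed.

Lemma increment_supportP i : increment_support m i -> exists2 q,
  (0 < q < nsegments m)%N & cpt m q = i.+1.
Proof.
move=> [/andP[i0 iN] /eqP ji].
have [|q /andP[q0 qM] /andP[c1 c2]] := @mem_segment i.+1; first by rewrite ltnS ltnW.
move: c1; rewrite leq_eqVlt => /orP[/eqP c1|c1]; last first.
  have e1 : entry m i.+1 = entry m (cpt m q.-1).
    by apply: entry_segment; rewrite ?q0// (ltnW c1).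
  have e2 : entry m i = entry m (cpt m q.-1).
    by apply: entry_segment; rewrite ?q0// -ltnS c1 ltnW.
  by move: ji; rewrite /increment e1 e2 subrr eqxx.
exists q.-1; last by [].
rewrite (leq_trans _ qM) ?ltn_predL// andbT lt0n; apply/eqP => q1.
by move: c1; rewrite q1 cpt0 => -[i00]; rewrite -i00 in i0.
Qed.
End segments.

(** The sign [sigma] treats peaks and valleys at once, a valley being a peak of the negated data. *)
Lemma flat_inside_extremum (R : realType) (N : nat) (sigma lam delta rho c : R)
    (y m m0 : 'rV[R]_N) (a0 i k j b0 : nat) :
  sigma = 1 \/ sigma = -1 ->
  0 <= delta < lam -> 0 < rho -> delta * N%:R < rho * (lam - delta) ->
  kkt lam y m -> noise_bounded delta y m0 ->
  (a0 < k < b0)%N -> (b0 <= N)%N -> (i < k < j)%N -> (j <= N)%N ->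
  (forall s, (i < s <= j)%N -> entry m0 s = c) ->
  (forall s, (a0 < s <= b0)%N -> sigma * entry m0 s <= sigma * c) ->
  0 <= sigma * dual y m a0 -> sigma * dual y m b0 <= 0 ->
  dual y m i = 0 \/ rho <= k%:R - i%:R ->
  dual y m j = 0 \/ rho <= j%:R - k%:R ->
  increment m k = 0.
Proof.
case=> -> hd rho0 rhoN Hkkt Hnoise ab bN ik jN m0c.
  rewrite !mul1r => m0le za zb.
  apply: (flat_inside_peak hd rho0 rhoN Hkkt Hnoise ab bN ik jN m0c) => //.
  by move=> s /m0le; rewrite !mul1r.
rewrite !mulN1r => m0le za zb anchi anchj; apply/eqP.
rewrite -oppr_eq0 -incrementN; apply/eqP.
apply: (flat_inside_peak hd rho0 rhoN (kktN Hkkt) (noise_boundedN Hnoise) ab bN ik jN (c := - c)).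
- by move=> s /m0c; rewrite entryN => ->.
- by move=> s /m0le; rewrite !mulN1r entryN.
- by rewrite dualN.
- by rewrite dualN.
- by case: anchi => [zi|]; [left; rewrite dualN zi oppr0|right].
- by case: anchj => [zj|]; [left; rewrite dualN zj oppr0|right].
Qed.

(** * Deterministic recovery under small noise *)

Section recovery.
Context (R : realType) (N : nat) (e lam delta M2 M3 : R) (r : nat).
Context (y m m0 : 'rV[R]_N).
Hypothesis N0 : (0 < N)%N.
Hypothesis long : forall q, (1 <= q <= nsegments m0)%N ->
  M2 * N%:R <= (cpt m0 q)%:R - (cpt m0 q.-1)%:R.
Hypothesis high : forall q, (1 <= q < nsegments m0)%N ->
  M3 <= `|entry m0 (cpt m0 q) - entry m0 (cpt m0 q).-1|.
Hypothesis alternate : forall q, (1 <= q)%N -> (q.+1 < nsegments m0)%N ->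
  jump_sign m0 q = - jump_sign m0 q.+1.
Hypotheses (r0 : (0 < r)%N) (re : r%:R <= e * N%:R) (rM2 : r%:R <= M2 * N%:R).
Hypotheses (delta0 : 0 <= delta < lam) (deltae : delta < e * (lam - delta)).
Hypothesis gap : 4 * lam + 2 * delta < r%:R * M3.
Hypotheses (Hkkt : kkt lam y m) (Hnoise : noise_bounded delta y m0).

Let M := nsegments m0.
(** Last index of segment [q], which is thus the half-open interval [(bp (q - 1), bp q]]; for an
    interior [q] it is also the index of the increment at the change point. *)
Let bp q := (cpt m0 q).-1.

Let lam0 : 0 < lam. Proof. by have /andP[h1 h2] := delta0; exact: le_lt_trans h2. Qed.

Let e0 : 0 < e.
Proof.
have rR : 0 < r%:R :> R by rewrite ltr0n.
have NR : 0 < N%:R :> R by rewrite ltr0n.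
by rewrite -(pmulr_lgt0 _ NR); exact: lt_le_trans re.
Qed.

Let cpt_gt0 q : (q <= M)%N -> (0 < cpt m0 q)%N.
Proof. by move=> qM; rewrite (leq_trans _ (cpt_le N0 (leq0n q) qM))// cpt0. Qed.

Let bpS q : (q <= M)%N -> (bp q).+1 = cpt m0 q.
Proof. by move=> qM; rewrite /bp prednK// cpt_gt0. Qed.

Let bp0 : bp 0 = 0%N. Proof. by rewrite /bp cpt0. Qed.

Let bpM : bp M = N. Proof. by rewrite /bp /M cpt_nsegments. Qed.

Let bp_gap q : (q < M)%N -> (bp q + r <= bp q.+1)%N.
Proof.
move=> qM; have := le_trans rM2 (@long q.+1 _).
rewrite ltnS leq0n qM => /(_ isT) /=.
by rewrite -!bpS ?(ltnW qM)// lerBrDr -natrD ler_nat; clear; lia.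
Qed.

Let bp_le q q' : (q <= q')%N -> (q' <= M)%N -> (bp q <= bp q')%N.
Proof. by move=> h1 h2; have := cpt_le N0 h1 h2; rewrite -!bpS// (leq_trans h1). Qed.

Let level q : R := entry m0 (cpt m0 q.-1).

Let entry_level q s : (0 < q <= M)%N -> (bp q.-1 < s <= bp q)%N ->
  entry m0 s = level q.
Proof.
move=> /andP[q0 qM] /andP[s1 s2]; apply: entry_segment; rewrite ?q0//.
have qM' : (q.-1 <= M)%N by rewrite (leq_trans (leq_pred _)).
by rewrite -!bpS// s1 ltnS.
Qed.

Let jump q := level q.+1 - level q.

Let jump_signE q : jump_sign m0 q = Num.sg (jump q).
Proof. by []. Qed.

Let jump_ge q : (0 < q < M)%N -> M3 <= `|jump q|.
Proof.
move=> qM; apply: le_trans (high qM) _; rewrite /jump /level /=.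
have := increment_cpt N0 qM; rewrite /increment.
have /andP[q0 /ltnW qM'] := qM.
by rewrite prednK ?cpt_gt0// => ->.
Qed.

Let increment_bp q : (0 < q < M)%N -> increment m0 (bp q) = jump q.
Proof. exact: increment_cpt. Qed.

(* Near a jump of [m0] the string has a kink in the same direction, hence
   touches the corresponding obstacle. *)
Let kink_near q : (0 < q < M)%N -> exists k,
  [/\ (bp q - r < k < bp q + r)%N, (0 < k < N)%N,
      Num.sg (increment m k) = Num.sg (jump q) &
      dual y m k = Num.sg (jump q) * lam].
Proof.
move=> /andP[q0 qM].
have g1 : (bp q.-1 + r <= bp q)%N.
  by have := @bp_gap q.-1; rewrite prednK// => -> //; exact: ltnW.
have g2 := bp_gap qM.
have bN : (bp q.+1 <= N)%N by rewrite -bpM bp_le.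
have rq : (0 < r <= bp q)%N by rewrite r0 (leq_trans (leq_addl _ _) g1).
have rN : (bp q + r <= N)%N by rewrite (leq_trans g2).
have left_level s : (bp q - r < s <= bp q)%N -> entry m0 s = level q.
  move=> /andP[s1 s2]; apply: entry_level; first by rewrite q0 ltnW.
  by rewrite s2 andbT (leq_ltn_trans _ s1)// leq_subRL ?(andP rq).2// addnC.
have right_level s : (bp q < s <= bp q + r)%N -> entry m0 s = level q.+1.
  move=> /andP[s1 s2]; apply: entry_level => //.
  by rewrite s1 (leq_trans s2).
have big : 4 * lam + 2 * delta < r%:R * `|jump q|.
  by rewrite (lt_le_trans gap)// ler_wpM2l// jump_ge// q0.
have range k : (bp q - r < k < bp q + r)%N -> (0 < k < N)%N.
  move=> /andP[k1 k2]; rewrite (leq_ltn_trans _ k1)//=.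
  exact: leq_trans k2 rN.
have [J|J|J] := ltgtP (jump q) 0; last 1 first.
- by move: big; rewrite J normr0 mulr0; have /andP[] := delta0; move: lam0; lra.
- have [|||k hk xk] := ascent_near_up_jump (ltW lam0) (kktN Hkkt)
      (noise_boundedN Hnoise) rq rN (u := - level q) (v := - level q.+1).
  + by move=> s /left_level <-; rewrite entryN.
  + by move=> s /right_level <-; rewrite entryN.
  + have -> : - level q.+1 - - level q = - jump q by rewrite /jump; ring.
    by rewrite -ltr0_norm.
  exists k; split=> //; first exact: range.
    by rewrite !ltr0_sg//; move: xk; rewrite incrementN oppr_gt0.
  have [_ _ ->] := Hkkt.2 k (range _ hk); first by rewrite ltr0_sg// mulN1r.
  by move: xk; rewrite incrementN oppr_gt0.
- have [|||k hk xk] := ascent_near_up_jump (ltW lam0) Hkkt Hnoise rq rN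
      (u := level q) (v := level q.+1).
  + exact: left_level.
  + exact: right_level.
  + by move: big; rewrite gtr0_norm.
  exists k; split=> //; first exact: range.
    by rewrite !gtr0_sg.
  by have [_ -> // _] := Hkkt.2 k (range _ hk); rewrite gtr0_sg// mul1r.
Qed.

Let windowP q k : (0 < k < N)%N -> (bp q - r < k < bp q + r)%N ->
  index_window N e (bp q) k.
Proof.
move=> kN /andP[k1 k2]; split=> //; rewrite (lt_le_trans _ re)//.
have [h|h] := leqP (bp q) k.
  rewrite ger0_norm ?subr_ge0 ?ler_nat//.
  by rewrite ltrBlDr -natrD ltr_nat addnC.
rewrite ler0_norm ?subr_le0 ?ler_nat ?(ltnW h)// opprB.
rewrite ltrBlDr -natrD ltr_nat; move: k1; clear; lia.
Qed.

(** Sign recovery comes from the kink near each jump. For flatness, [k] lies in a segment whose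
    level is a local extremum of [m0], because consecutive signs differ; the kinks near its ends, or
    the ends of the sample where [dual] vanishes, provide the anchors [a0] and [b0]. *)
Lemma recovers_support_of_small_noise : recovers_support e m m0.
Proof.
split; last first.
  move=> i /[dup] iS /(increment_supportP N0)[q qM qi].
  have iE : i = bp q by rewrite /bp qi.
  rewrite iE; have [k [hk kN sgk _]] := kink_near qM.
  exists k; first exact: windowP.
  by rewrite sgk increment_bp.
move=> k kN out.
(* [k] is only known to avoid windows around the support, so [bp q] must first be shown to belong to
   it. *)
have far q : (0 < q < M)%N -> e * N%:R <= `|k%:R - (bp q)%:R|.
  move=> qM; rewrite leNgt; apply/negP => near_q; apply: out.
  exists (bp q); last by split.
  have /andP[q0 qM'] := qM.
  split; last first.
    move/eqP; rewrite increment_bp// => J.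
    have := jump_ge qM; rewrite (eqP J) normr0 => M30.
    have := ler_wpM2l (ler0n R r) M30; rewrite mulr0.
    by move: gap lam0; have /andP[] := delta0; lra.
  have := bp_gap qM'.
  have := @bp_gap q.-1; rewrite prednK// => /(_ (ltnW qM')).
  have := bp_le (qM' : (q.+1 <= M)%N) (leqnn M); rewrite bpM.
  by move: r0; clear; lia.
have /andP[k0 kltN] := kN.
have [q qM' /andP[k1 k2]] : exists2 q, (0 < q <= M)%N &
    (cpt m0 q.-1 <= k < cpt m0 q)%N.
  by apply: mem_segment; rewrite // k0 ltnW.
have /andP[q0 qM] := qM'.
have {}k1 : (bp q.-1 < k)%N by rewrite bpS ?(leq_trans (leq_pred _))//.
have {}k2 : (k <= bp q)%N by rewrite -ltnS bpS.
have jump_sg p : (0 < p < M)%N -> Num.sg (jump p) = 1 \/ Num.sg (jump p) = -1.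
  move=> pM; have [J|J|J] := ltgtP (jump p) 0.
  - by right; rewrite ltr0_sg.
  - by left; rewrite gtr0_sg.
  - exfalso; have := jump_ge pM; rewrite J normr0 => M30.
    have := ler_wpM2l (ler0n R r) M30; rewrite mulr0.
    by move: gap lam0; have /andP[] := delta0; lra.
have predM : (1 < q)%N -> (0 < q.-1 < M)%N by move: qM; clear; lia.
have far_left : (1 < q)%N -> e * N%:R <= k%:R - (bp q.-1)%:R.
  move=> q1; have := far q.-1; rewrite ger0_norm ?subr_ge0 ?ler_nat ?(ltnW k1)//.
  by apply; exact: predM.
have far_right : (q < M)%N -> e * N%:R <= (bp q)%:R - k%:R.
  move=> qltM; have := far q; rewrite ler0_norm ?subr_le0 ?ler_nat// opprB.
  by apply; rewrite q0.
(* [sigma] is 1 on a peak and -1 on a valley. An end segment takes it from its only neighbour; for a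
   constant signal the choice is arbitrary. *)
have [sigma [sig1 sl sr]] : exists sigma : R, [/\ sigma = 1 \/ sigma = -1,
    q = 1%N \/ (1 < q)%N /\ Num.sg (jump q.-1) = sigma &
    q = M \/ (q < M)%N /\ Num.sg (jump q) = - sigma].
  have [q1|q1] : q = 1%N \/ (1 < q)%N.
    by move: q0; case: (q) => [|[|?]] // _; [left|right].
  - have [qE|qltM] : q = M \/ (q < M)%N.
      by move: qM; rewrite leq_eqVlt => /orP[/eqP|]; [left|right].
    + exists 1; split; [by left|by left|by left].
    + exists (- Num.sg (jump q)); split; [|by left|by right; rewrite opprK].
      by have [|->|->] := jump_sg q; rewrite ?q0// ?opprK; [right|left].
  - have pM := predM q1.
    exists (Num.sg (jump q.-1)); split; [exact: jump_sg|by right|].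
    have [qE|qltM] : q = M \/ (q < M)%N.
      by move: qM; rewrite leq_eqVlt => /orP[/eqP|]; [left|right].
    + by left.
    + right; split=> //; have /andP[p0 _] := pM.
      have := alternate p0; rewrite prednK// => /(_ qltM).
      by rewrite !jump_signE => ->; rewrite opprK.
have sig2 : sigma * sigma = 1 by case: sig1 => ->; ring.
(* [a0] is a contact less than [r] away from the left end of the segment, hence before [k] because
   [r <= e N]. In the first segment it is 0, where [dual] vanishes. *)
have [a0 [a0k m0a za]] : exists a0, [/\ (a0 < k)%N,
    forall s, (a0 < s <= bp q.-1)%N -> sigma * entry m0 s <= sigma * level q &
    0 <= sigma * dual y m a0].
  case: sl => [q1|[q1 sgq]].
    exists 0%N; split=> //; last by rewrite dual0 mulr0.
    by move=> s; rewrite q1 bp0; case: s.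
  have pM := predM q1.
  have /andP[p0 pltM] := pM.
  have [k' [/andP[hk1 hk2] kN' _ dk]] := kink_near pM.
  exists k'; split.
  - rewrite (leq_trans hk2)// -(ler_nat R) natrD -lerBrDl.
    exact: le_trans re (far_left q1).
  - move=> s /andP[s1 s2].
    rewrite (@entry_level q.-1) ?p0 ?(ltnW pltM)//; last first.
      rewrite s2 andbT; have := @bp_gap q.-2; rewrite prednK// => /(_ (ltnW pltM)).
      by move: hk1 s1; clear; lia.
    rewrite -subr_ge0 -mulrBr -[X in _ - level X]/(q.-1).
    have -> : level q - level q.-1 = jump q.-1 by rewrite /jump prednK.
    by rewrite -sgq -normrEsg.
  - by rewrite dk sgq mulrA sig2 mul1r ltW.
have [b0 [kb0 b0N m0b zb]] : exists b0, [/\ (k < b0)%N, (b0 <= N)%N,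
    forall s, (bp q < s <= b0)%N -> sigma * entry m0 s <= sigma * level q &
    sigma * dual y m b0 <= 0].
  case: sr => [qE|[qltM sgq]].
    exists N; split=> //; last by rewrite Hkkt.1 mulr0.
    by move=> s; rewrite qE bpM => /andP[s1 s2]; move: s1; rewrite ltnNge s2.
  have pM : (0 < q < M)%N by rewrite q0.
  have [k' [/andP[hk1 hk2] /andP[_ kN'] _ dk]] := kink_near pM.
  exists k'; split.
  - have : (k + r <= bp q)%N.
      by rewrite -(ler_nat R) natrD -lerBrDl; exact: le_trans re (far_right qltM).
    by move: hk1; clear; lia.
  - exact: ltnW.
  - move=> s /andP[s1 s2]; rewrite (@entry_level q.+1) ?ltnS//; last first.
      by rewrite s1 (leq_trans s2)// (leq_trans (ltnW hk2))// bp_gap.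
    rewrite -subr_le0 -mulrBr -/(jump q) -[sigma]opprK -sgq mulNr oppr_le0.
    by rewrite -normrEsg.
  - by rewrite dk sgq mulrA mulrN sig2 mulN1r oppr_le0 ltW.
(* [k = bp q] would be a jump at distance 0, or the index [N]. *)
have kj : (k < bp q)%N.
  rewrite ltn_neqAle k2 andbT; apply/eqP => kq.
  have [qE|qltM] : q = M \/ (q < M)%N.
    by move: qM; rewrite leq_eqVlt => /orP[/eqP|]; [left|right].
    by move: kltN; rewrite kq qE bpM ltnn.
  have := far_right qltM; rewrite kq subrr.
  by have := mulr_gt0 e0 (_ : 0 < N%:R); rewrite ltr0n => /(_ N0); lra.
apply: (@flat_inside_extremum R N sigma lam delta (e * N%:R) (level q) y m m0
  a0 (bp q.-1) k (bp q) b0) => //.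
- by rewrite mulr_gt0// ltr0n.
- by rewrite mulrAC ltr_pM2r// ltr0n.
- by rewrite a0k.
- by rewrite k1.
- by rewrite -bpM bp_le.
- by move=> s hs; apply: entry_level.
- move=> s /andP[s1 s2].
  have [h1|h1] := leqP s (bp q.-1); first by rewrite m0a// s1.
  have [h2|h2] := leqP s (bp q); last by rewrite m0b// h2.
  by rewrite (entry_level qM') ?h1.
- case: sl => [->|[q1 _]]; first by left; rewrite bp0 dual0.
  by right; exact: far_left.
- case: sr => [->|[qltM _]]; first by left; rewrite bpM Hkkt.1.
  by right; exact: far_right.
Qed.
End recovery.

(** * Asymptotics *)

Section growth.
Context (R : realType).

Lemma near_le_powR (p B : R) : 0 < p -> \forall N \near \oo, B <= N%:R `^ p.
Proof.
move=> p0; near=> N.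
have [B0|B0] := leP B 0; first by rewrite (le_trans B0)// powR_ge0.
have : B `^ p^-1 <= N%:R.
  by near: N; apply: nbhs_infty_ger.
move=> /(ge0_ler_powR (ltW p0)); rewrite !nnegrE powR_ge0 ler0n => /(_ isT isT).
by rewrite -powRrM mulVf ?gt_eqF// powRr1// ltW.
Unshelve. all: by end_near. Qed.

Lemma near_powR_le (p gamma : R) : p < 1 -> 0 < gamma ->
  \forall N \near \oo, N%:R `^ p <= gamma * N%:R.
Proof.
move=> p1 g0; near=> N.
have N0 : 0 < N%:R :> R by rewrite ltr0n; near: N; exists 1%N.
have : gamma^-1 <= N%:R `^ (1 - p).
  by near: N; apply: near_le_powR; rewrite subr_gt0.
move=> /(ler_wpM2l (powR_ge0 N%:R p)).
rewrite -powRD ?(gt_eqF N0) ?implybT// addrC subrK powRr1 ?(ltW N0)//.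
by rewrite ler_pdivrMr// mulrC.
Unshelve. all: by end_near. Qed.

(** A single term of the exponential series, of degree [n + 1] with [p (n + 1) >= 2], already grows
    at least like [N ^ 2]. *)
Lemma near_le_expR_powR (p b : R) : 0 < p -> 0 < b ->
  \forall N \near \oo, 2 * N.+1%:R <= expR (b * N%:R `^ p).
Proof.
move=> p0 b0.
pose n := Num.truncn (2 / p).
have np : 2 <= p * n.+1%:R.
  by rewrite mulrC -ler_pdivrMr// ltW// truncnS_gt.
pose c := b ^+ n.+1 / n.+1`!%:R.
have c0 : 0 < c by rewrite divr_gt0 ?exprn_gt0// ltr0n fact_gt0.
near=> N.
have N1 : 1 <= N%:R :> R by rewrite ler1n; near: N; exists 1%N.
have cN : 4 / c <= N%:R by near: N; apply: nbhs_infty_ger.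
apply: le_trans (expR_ge1Dxn n _); last by rewrite mulr_ge0 ?powR_ge0// ltW.
have : N%:R ^+ 2 <= (N%:R `^ p) ^+ n.+1.
  by rewrite -!powR_mulrn ?powR_ge0 ?ler0n// -powRrM ler_powR.
rewrite exprMn mulrAC -/c => /(ler_wpM2l (ltW c0)).
have := cN; rewrite ler_pdivrMr// => h4.
have : 4 * N%:R <= c * N%:R ^+ 2 by nra.
by rewrite -[N.+1]addn1 natrD; lra.
Unshelve. all: by end_near. Qed.

(** From some rank on every quotient is at least [C], hence so is the limit inferior. Monotonicity
    of [lne], with [lne 0 = -oo], covers vanishing probabilities too. *)
Lemma exp_dominated_near (p : nat -> \bar R) (u : nat -> R) (C : R) : 0 < C ->
  (\forall n \near \oo, 0 < u n /\ (0 <= p n <= (expR (- (C * u n)))%:E)%E) ->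
  exp_dominated p u.
Proof.
move=> C0 [n0 _ H]; exists C => //.
rewrite limn_einf_lim; apply: lime_ge; first exact: is_cvg_einfs.
exists n0 => // n /= n0n; apply: le_ereal_inf_tmp => _ [k /= nk <-].
have [u0 /andP[p0 pk]] := H k (leq_trans n0n nk).
have L : (lne (p k) <= (- (C * u k))%:E)%E.
  rewrite -[X in (_ <= X%:E)%E]expRK -lne_EFin ?expR_gt0//.
  by rewrite lee_lne ?in_itv/= ?leey ?p0 ?lee_fin ?expR_ge0.
rewrite -[X in (X <= _)%E](_ : ((C * u k)%:E * ((u k)^-1)%:E = _)%E); last first.
  by rewrite -EFinM mulfK// gt_eqF.
by rewrite lee_wpmul2r ?lee_fin ?invr_ge0 ?(ltW u0)// leeNr -EFinN.
Qed.

End growth.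

(** * From the deterministic statement to the failure probability *)

Lemma psi1_norm_bounded (R : realType) (d : nat -> measure_display)
    (T : forall N : nat, measurableType (d N))
    (P : forall N : nat, probability (T N) R)
    (X : forall N : nat, 'I_N -> {RV (P N) >-> R}) :
  (ereal_sup (range (fun N : nat => \big[maxe/-oo]_(i < N) psi1_norm (X N i))) < +oo)%E ->
  exists2 K : R, 0 < K & forall N i, (psi1_norm (X N i) <= K%:E)%E.
Proof.
set s := ereal_sup _ => s_lty.
have Xs N i : (psi1_norm (X N i) <= s)%E.
  apply: (@le_trans _ _ (\big[maxe/-oo]_(i < N) psi1_norm (X N i))%E).
    exact: (le_bigmax _ (fun i => psi1_norm (X N i))).
  by apply: ereal_sup_ubound; exists N.
exists (Num.max 1 (fine s)) => [|N i]; first by rewrite lt_max ltr01.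
apply: le_trans (Xs N i) _.
case: s s_lty {Xs} => [r|//|_] => [_|]; last by rewrite leNye.
by rewrite lee_fin le_max lexx orbT.
Qed.

(** Flatness is also put in terms of signs, so that failure is built by countable operations from
    events on the sign of one increment. *)
Lemma measurable_recovery_failure (R : realType) d (T : measurableType d)
    (N : nat) (e : R) (mhat : T -> 'rV[R]_N) (m0 : 'rV[R]_N) :
  (forall t, measurable_fun setT (fun w => entry (mhat w) t)) ->
  measurable [set w | ~ recovers_support e (mhat w) m0].
Proof.
move=> mm.
have mx t : measurable_fun setT (fun w => increment (mhat w) t).
  by apply: measurable_funB; exact: mm.
have msg k (z : R) : measurable [set w | Num.sg (increment (mhat w) k) = Num.sg z].
  pose B := [set x : R | Num.sg x = Num.sg z].
  rewrite (_ : [set _ | _] = setT `&` (fun w => increment (mhat w) k) @^-1` B).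
    apply: mx => //; rewrite /B.
    have [z0|z0|->] := ltgtP z 0.
    - rewrite (_ : [set _ | _] = [set` `]-oo, 0[]); first exact: measurable_itv.
      apply/seteqP; split => x /=; rewrite in_itv/= (ltr0_sg z0).
        by move/eqP; rewrite sgr_cp0.
      exact: ltr0_sg.
    - rewrite (_ : [set _ | _] = [set` `]0, +oo[]); first exact: measurable_itv.
      apply/seteqP; split => x /=; rewrite in_itv/= andbT (gtr0_sg z0).
        by move/eqP; rewrite sgr_cp0.
      exact: gtr0_sg.
    - rewrite (_ : [set _ | _] = [set 0]); first exact: measurable_set1.
      apply/seteqP; split => x /=; rewrite sgr0; last by move=> ->; rewrite sgr0.
      by move/eqP; rewrite sgr_eq0 => /eqP.
  by rewrite setTI.
rewrite (_ : [set _ | _] = ~` (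
  (\bigcap_(k in [set k | (1 <= k < N)%N /\
      ~ (\bigcup_(i in increment_support m0) index_window N e i) k])
    [set w | Num.sg (increment (mhat w) k) = Num.sg 0]) `&`
  (\bigcap_(i in increment_support m0) \bigcup_(k in index_window N e i)
    [set w | Num.sg (increment (mhat w) k) = Num.sg (increment m0 i)]))).
  apply: measurableC; apply: measurableI.
    by apply: bigcap_measurableType.
  by apply: bigcap_measurableType => i _; exact: bigcup_measurable.
apply: eq_set => w /=; apply/propext; split; apply: contra_not.
  move=> [h1 h2]; split=> [k k1 k2|i /h2[k ? ?]]; last by exists k.
  by have := h1 k (conj k1 k2); rewrite /= sgr0 => /eqP; rewrite sgr_eq0 => /eqP.
move=> [h1 h2]; split=> [k [k1 k2] /=|i /h2[k ? ?]]; last by exists k.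
by rewrite h1// !sgr0.
Qed.

(** A block sum is a difference of two partial sums, whence the factor 2. *)
Lemma noise_bounded_of_partial_sums (R : realType) (N : nat) (s : R)
    (m0 : 'rV[R]_N) (x : 'I_N -> R) :
  (forall t, (t <= N)%N -> `|\sum_(i < N | (i < t)%N) x i| < s) ->
  noise_bounded (2 * s) (m0 + \row_i x i) m0.
Proof.
move=> xs a b /andP[ab bN].
pose row := \row_i x i.
have partial t : (t <= N)%N ->
    \sum_(1 <= j < t.+1) entry row j = \sum_(i < N | (i < t)%N) x i.
  move=> tN; rewrite big_add1/= big_mkord (big_ord_widen N (fun i => entry row i.+1))//.
  by apply: eq_bigr => i _; rewrite entry_succ mxE.
rewrite (eq_bigr (fun j => entry row j)); last first.
  by move=> j _; rewrite entryD addrC addKr.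
have -> : \sum_(a.+1 <= j < b.+1) entry row j =
    \sum_(1 <= j < b.+1) entry row j - \sum_(1 <= j < a.+1) entry row j.
  by rewrite [X in _ = X - _](@big_cat_nat _ _ _ a.+1)//=; ring.
rewrite !partial// ?(leq_trans ab)// (le_trans (ler_normB _ _))//.
by rewrite mulr2n mulrDl mul1r lerD// ltW// xs// (leq_trans ab).
Qed.

Theorem corollary2p1 (R : realType)
  (d : nat -> measure_display) (T : forall N : nat, measurableType (d N))
  (P : forall N : nat, probability (T N) R)
  (m0 : forall N : nat, 'rV[R]_N)
  (noise : forall N : nat, 'I_N -> {RV (P N) >-> R})
  (mhat : forall N : nat, T N -> 'rV[R]_N)
  (M1 M2 M3 M4 M5 c1 e : R)
  (hindep : forall N : nat, mutually_independent (noise N))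
  (hmean : forall (N : nat) (i : 'I_N), ('E_(P N)[noise N i] = 0)%E)
  (hsubexp : forall (N : nat) (i : 'I_N), sub_exponential (noise N i))
  (hcont : forall (N : nat) (i : 'I_N), continuous_distribution (noise N i))
  (hkappa : (ereal_sup (range (fun N : nat =>
               \big[maxe/-oo]_(i < N) psi1_norm (noise N i))) < +oo)%E)
  (hM1 : 0 < M1) (hM2 : 0 < M2) (hM3 : 0 < M3) (hM4 : 0 < M4) (hM5 : 0 < M5)
  (hc1 : 2^-1 < c1 < 1)
  (ha : forall N : nat, (nsegments (m0 N))%:R <= M1)
  (hb : forall N k : nat, (1 <= k <= nsegments (m0 N))%N ->
     M2 * N%:R <= (cpt (m0 N) k)%:R - (cpt (m0 N) k.-1)%:R)
  (hc_lower : forall N k : nat, (1 <= k < nsegments (m0 N))%N ->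
     M3 <= `|entry (m0 N) (cpt (m0 N) k) - entry (m0 N) (cpt (m0 N) k).-1|)
  (hc_upper : forall N : nat, (1 < nsegments (m0 N))%N ->
     exists2 k : nat, (1 <= k < nsegments (m0 N))%N &
       `|entry (m0 N) (cpt (m0 N) k) - entry (m0 N) (cpt (m0 N) k).-1| <= M4)
  (he : forall N k : nat, (1 <= k)%N -> (k.+1 < nsegments (m0 N))%N ->
     jump_sign (m0 N) k = - jump_sign (m0 N) k.+1)
  (hmhat : forall (N : nat) (w : T N),
     flsa_solution (M5 * (N%:R `^ c1)) (m0 N + \row_i noise N i w) (mhat N w))
  (heps : 0 < e) :
  exp_dominated
    (fun N : nat => P N [set w | ~ recovers_support e (mhat N w) (m0 N)])
    (fun N : nat => N%:R `^ (2 * c1 - 1)).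
Proof.
have [K K0 psi1K] := psi1_norm_bounded hkappa.
have /andP[c1_gt c1_lt] := hc1.
pose A := expR 1 * K.
have A0 : 0 < A by rewrite mulr_gt0// expR_gt0.
(* [delta] will be [dl * lam]; since [dl (1 + e) = e / 2], one gets [dl < e (1 - dl)], the condition
   that excludes far kinks. *)
pose dl := e / (2 * (1 + e)).
have e1 : 0 < 2 * (1 + e) by lra.
have dl0 : 0 < dl by rewrite divr_gt0.
have dlE : dl * (2 * (1 + e)) = e by rewrite divfK// gt_eqF.
have dl1 : dl < 1 by nra.
have dle : dl < e * (1 - dl) by nra.
(* A radius of [eta N] fits both the recovery windows and the segments. *)
pose eta := Num.min e M2.
have eta0 : 0 < eta by rewrite lt_min heps.
(* The threshold [b N ^ c1] for the partial sums is [dl lam / 2]; the Chernoff exponent there is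
   [a N ^ (2 c1 - 1)], with [a] defined below. *)
pose b := dl * M5 / 2.
have b0 : 0 < b by rewrite /b; nra.
pose a := b ^+ 2 / (8 * A ^+ 2).
have a0 : 0 < a by rewrite divr_gt0 ?exprn_gt0 // mulr_gt0 // exprn_gt0.
have p0 : 0 < 2 * c1 - 1 by lra.
(* Half of the exponent is given up to absorb the factor [2 (N + 1)]. *)
apply: (@exp_dominated_near _ _ _ (a / 2)); first by rewrite divr_gt0.
near=> N.
have N0 : (0 < N)%N by near: N; exists 1%N.
have NR0 : 0 < N%:R :> R by rewrite ltr0n.
set u := N%:R `^ (2 * c1 - 1).
have u0 : 0 < u by rewrite powR_gt0.
have Nc1_gt0 : 0 < N%:R `^ c1 by rewrite powR_gt0.
pose lam := M5 * N%:R `^ c1.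
have lam0 : 0 < lam by rewrite mulr_gt0.
(* Truncation loses at most half of [eta N] once [eta N >= 2]. *)
pose r := Num.truncn (eta * N%:R).
have r_le : r%:R <= eta * N%:R by rewrite truncn_le// mulr_ge0// ltW.
have r_gt : eta * N%:R - 1 < r%:R by rewrite ltrBlDr natr1 truncnS_gt.
have eta_large : 2 <= eta * N%:R.
  by rewrite mulrC -ler_pdivrMr//; near: N; apply: nbhs_infty_ger.
(* Yields [4 lam + 2 delta <= 6 lam <= eta M3 N / 4], which is below [r M3] because
   [r >= eta N / 2]. *)
have lam_small : 6 * lam <= (eta * M3 / 4) * N%:R.
  have : N%:R `^ c1 <= (eta * M3 / 4 / (6 * M5)) * N%:R.
    by near: N; apply: near_powR_le => //; rewrite !(divr_gt0, mulr_gt0).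
  have h6 : 0 < 6 * M5 by rewrite mulr_gt0.
  by rewrite mulrAC ler_pdivlMr// mulrC mulrA.
have s_small : b * N%:R `^ c1 <= 2 * A * N%:R.
  have : N%:R `^ c1 <= (2 * A / b) * N%:R.
    by near: N; apply: near_powR_le => //; rewrite divr_gt0// mulr_gt0.
  by rewrite mulrAC ler_pdivlMr// mulrC.
have N_small : 2 * N.+1%:R <= expR (a / 2 * u).
  by rewrite /u; near: N; apply: near_le_expR_powR => //; rewrite divr_gt0.
split=> //; rewrite measure_ge0 /=.
have mnoise i : measurable_fun setT (noise N i) by [].
have mF : measurable [set w | ~ recovers_support e (mhat N w) (m0 N)].
  apply: measurable_recovery_failure => t.
  exact: (measurable_entry_flsa t (ltW lam0) mnoise (@hmhat N)).
have bound := @partial_sums_tail R _ _ (P N) N (noise N) K (b * N%:R `^ c1) _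
  (@hindep N) (@hmean N) K0 (psi1K N) N0 _ mF _.
apply: le_trans (bound _ _) _.
- by rewrite s_small mulr_ge0 ?ltW.
- move=> w fails; have [//|small] := pselect (exists2 t : nat, (t <= N)%N &
    b * N%:R `^ c1 <= `|\sum_(i < N | (i < t)%N) noise N i w|).
  exfalso; apply: fails.
  apply: (@recovers_support_of_small_noise R N e lam (dl * lam) M2 M3 r
    (m0 N + \row_i noise N i w)) => //.
  + by move=> q hq; exact: hb.
  + by move=> q hq; exact: hc_lower.
  + by move=> q; exact: he.
  + by rewrite -(ltr0n R) (le_lt_trans _ r_gt)// subr_ge0 (le_trans _ eta_large)// ler1n.
  + by rewrite (le_trans r_le)// ler_wpM2r// ge_min lexx.
  + by rewrite (le_trans r_le)// ler_wpM2r// ge_min lexx orbT.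
  + by rewrite mulr_ge0 ?(ltW dl0) ?(ltW lam0)//= gtr_pMl.
  + have -> : e * (lam - dl * lam) = e * (1 - dl) * lam by ring.
    by rewrite ltr_pM2r.
  + have : dl * lam <= lam by rewrite ger_pMl// ltW.
    have r_half : eta * N%:R / 2 <= r%:R by move: eta_large r_gt; clear; lra.
    have := ler_wpM2r (ltW hM3) r_half.
    have : 0 < eta * N%:R * M3 by rewrite !mulr_gt0.
    by move: lam_small; clear; lra.
  + exact: flsa_kkt (ltW lam0) (@hmhat N w).
  + rewrite (_ : dl * lam = 2 * (b * N%:R `^ c1)); last by rewrite /b /lam; field.
    apply: noise_bounded_of_partial_sums => t tN; rewrite ltNge; apply/negP => h.
    by apply: small; exists t.
rewrite lee_fin -/A.
have -> : (b * N%:R `^ c1) ^+ 2 / (8 * A ^+ 2 * N%:R) = a * u.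
  rewrite /u powRB ?(gt_eqF NR0) ?implybT// powRr1 ?(ltW NR0)//.
  rewrite [2 * c1]mulrC powRrM powR_mulrn ?powR_ge0// /a.
  by field; rewrite !gt_eqF.
apply: le_trans (ler_wpM2r (expR_ge0 _) N_small) _.
by rewrite -expRD ler_expR; lra.
Unshelve. all: by end_near. Qed.
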